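(* If $A=\{x\}$, then $$\lambda_A=e(1+\nu^{-1})^{-\nu}=1.7336105\dots,$$ where $\nu$ is the positive root of the transcendental equation $$(1+\nu)\log(1+\nu^{-1})+\frac{\log\nu}{1+\nu}=1.$$ Moreover, $$d\mu_A=\frac{2\sqrt{(b-x)(x-a)}}{\pi\,(a+b-2\sqrt{ab})\,x}\,dx$$ on $[a,b]$, where $$a=e(1+\nu^{-1})^{-\nu}\left(1-\frac{1}{\sqrt{\nu+1}}\right)^2,\qquad b=e(1+\nu^{-1})^{-\nu}\left(1+\frac{1}{\sqrt{\nu+1}}\right)^2.$$
   Context: $\mathbb{R}^+=[0,\infty)$, and $I(\mu)=\iint\log|x_1-x_2|\,d\mu(x_1)\,d\mu(x_2)$ is the logarithmic energy. For a finite set $A\subset\mathbb{Z}[x]$ of nonzero polynomials with only real roots, $\lambda_A=\inf_\mu\int x\,d\mu(x)$, where $\mu$ ranges over the Borel probability measures supported on $\mathbb{R}^+$ with $I(\mu)\ge 0$ and $\int\log|Q(x)|\,d\mu(x)\ge0$ for every $Q\in A$. $\mu_A$ denotes the unique such measure attaining the infimum. *)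

(* Defs.v *)
From HB Require Import structures.
From mathcomp Require Import all_boot all_order all_algebra finmap.
From mathcomp Require Import all_classical all_reals all_analysis.
Set Implicit Arguments.
Unset Strict Implicit.
Unset Printing Implicit Defensive.
Import Order.TTheory GRing.Theory Num.Theory.
Import numFieldNormedType.Exports.
Local Open Scope classical_set_scope.
Local Open Scope ring_scope.

(* Logarithms are taken with the extended-real [lne], for which
   [lne 0%E = -oo]; the real-valued [ln] has [ln 0 = 0], which would give atoms
   finite energy.
   For measures on [0, +oo[ with infinite mean the integrals of logarithms may
   be of the form (+oo) - (+oo), which the library evaluates to -oo; such
   measures have no influence on an infimum of means.
   Probabilities are functions on all sets, constrained on measurable ones
   only, hence equality of measures is stated on measurable sets. *)

Section TraceProblem.
Variable R : realType.
Implicit Types (mu : probability (measurableTypeR R) R) (A : {fset {poly int}}).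

Definition log_energy mu : \bar R :=
  (\int[mu \x mu]_z lne (`|z.1 - z.2|%:E))%E.

Definition log_integral (Q : {poly int}) mu : \bar R :=
  (\int[mu]_x lne (`|(map_poly intr Q).[x]|%:E))%E.

Definition mean mu : \bar R := (\int[mu]_x x%:E)%E.

(* [0, +oo[ is closed, so this says that the support of mu lies in it. *)
Definition supported_on_Rplus mu : Prop := mu (~` `[0, +oo[) = 0%E.

Definition admissible A mu : Prop :=
  [/\ supported_on_Rplus mu,
      (0 <= log_energy mu)%E &
      forall Q, Q \in A -> (0 <= log_integral Q mu)%E].

Definition lambda A : \bar R :=
  ereal_inf [set mean mu | mu in [set mu | admissible A mu]].

Definition attains_lambda A mu : Prop :=
  admissible A mu /\ mean mu = lambda A.

Definition is_extremal_measure A mu : Prop :=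
  attains_lambda A mu /\
  forall mu', attains_lambda A mu' -> forall S, measurable S -> mu' S = mu S.

Definition has_density_on mu (D : set R) (f : R -> R) : Prop :=
  forall S : set (measurableTypeR R), measurable S ->
    mu S = (\int[lebesgue_measure]_(x in S `&` D) (f x)%:E)%E.

End TraceProblem.

Arguments lambda : clear implicits.

Section Siegel.
Variable R : realType.
Implicit Types nu x : R.

Definition siegel_root nu : Prop :=
  0 < nu /\ (1 + nu) * ln (1 + nu^-1) + ln nu / (1 + nu) = 1.

Definition siegel_value nu : R := expR 1 * (1 + nu^-1) `^ (- nu).

Definition left_end nu : R :=
  siegel_value nu * (1 - 1 / Num.sqrt (nu + 1)) ^+ 2.

Definition right_end nu : R :=
  siegel_value nu * (1 + 1 / Num.sqrt (nu + 1)) ^+ 2.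

Definition siegel_density (a b x : R) : R :=
  2 * Num.sqrt ((b - x) * (x - a)) /
  (pi * (a + b - 2 * Num.sqrt (a * b)) * x).

End Siegel.

(* Main.v *)
Require Import Defs.
From HB Require Import structures.
From mathcomp Require Import all_boot all_order all_algebra finmap.
From mathcomp Require Import all_classical all_reals all_analysis.
From mathcomp Require Import measurable_realfun ring lra.
Import Order.TTheory GRing.Theory Num.Theory.
Import numFieldNormedType.Exports.
Local Open Scope classical_set_scope.
Local Open Scope ring_scope.
Set Implicit Arguments.
Unset Strict Implicit.
Unset Printing Implicit Defensive.

(* Put [s = siegel_value nu] and [q = 1 / sqrt (nu + 1)].  In the variable [t]
   with [x = s * (1 + q ^+ 2 + 2 * q * cos t)] the candidate [mu0] has density
   [2 / pi * sin t ^+ 2 / (1 + q ^+ 2 + 2 * q * cos t)] on [0, pi].  Its cosine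
   moments satisfy a three-term recurrence, and the expansion of
   [ln (1 - 2 z cos t + z ^+ 2)] then gives its logarithmic potential [U], for
   which [2 U(x) + nu ln x + nu + 1 <= (nu + 1) x / s] for every [x > 0], with
   equality on the support.

   The kernel [- ln |x - y|] is positive definite on neutral measures, being up
   to a controlled error a mixture of the kernels [max(0, r - |x - y|)], so an
   admissible [mu] of mean [M] satisfies [2 * \int U dmu >= D], where [D >= 0]
   vanishes only for [mu = mu0].  Integrating the inequality for [U] against
   [mu], and using [\int ln x dmu >= 0], one gets [D <= (nu + 1) (M / s - 1)]:
   hence [M >= s], and [mu = mu0] when [M = s]. *)

(** * Real calculus *)

(** [nu] is the ratio of the Lagrange multipliers of the constraints [\int ln x >= 0] and
    nonnegative energy, and the inequality for [U] is the optimality condition of the minimisation.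
    Both constraints are tight at the optimum: the first fixes [ln s] in terms of [nu], the second
    fixes the additive constant of [U], and eliminating [s] leaves the transcendental equation. The
    obstacle is the singularity of the logarithm. Energies and cross energies are not known to be
    finite beforehand, so comparisons use the nonnegative kernel [log_gap] and are written without
    subtraction until finiteness is available. Moreover, on the support the expansion of the
    logarithm sits on its circle of convergence; there [U] is reached through kernels of radius
    [r < 1], a majorant giving one inequality and Fatou's lemma the other. *)

Section Calculus.
Variable R : realType.
Implicit Types (f g : R -> R) (a b x t : R).

Lemma is_derive_continuous f (df : R) x :
  is_derive x 1 f df -> {for x, continuous f}.
Proof. by move=> h; apply/differentiable_continuous/derivable1_diffP; apply: ex_derive. Qed.

Lemma is_derive1_cst (c x : R) : is_derive x 1 (fun _ => c) 0.
Proof. exact: (is_derive_cst c x 1). Qed.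

Lemma is_derive1_id x : is_derive x 1 (fun y => y) 1.
Proof. exact: (is_derive_id x 1). Qed.

Lemma is_derive1D f g x (df dg : R) :
  is_derive x 1 f df -> is_derive x 1 g dg ->
  is_derive x 1 (fun y => f y + g y) (df + dg).
Proof. by move=> hf hg; exact: (is_deriveD hf hg). Qed.

Lemma is_derive1B f g x (df dg : R) :
  is_derive x 1 f df -> is_derive x 1 g dg ->
  is_derive x 1 (fun y => f y - g y) (df - dg).
Proof. by move=> hf hg; exact: (is_deriveB hf hg). Qed.

Lemma is_derive1Z (c : R) f x (df : R) :
  is_derive x 1 f df -> is_derive x 1 (fun y => c * f y) (c * df).
Proof. by move=> hf; exact: (is_deriveZ c hf). Qed.

Lemma is_derive1M f g x (df dg : R) :
  is_derive x 1 f df -> is_derive x 1 g dg ->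
  is_derive x 1 (fun y => f y * g y) (df * g x + f x * dg).
Proof.
move=> hf hg; apply: (is_derive_eq (is_deriveM hf hg)).
by rewrite /GRing.scale/= addrC [g x * df]mulrC.
Qed.

Lemma is_derive1X (n : nat) x :
  is_derive x 1 (fun y => y ^+ n) (n%:R * x ^+ n.-1).
Proof.
have -> : (fun y : R => y ^+ n) = id ^+ n by apply/funext => y; rewrite exprfctE.
apply: (is_derive_eq (is_deriveX n (is_derive_id x 1))).
by rewrite /GRing.scale/= mulr1.
Qed.

Lemma is_derive1_ln_comp f x (df : R) : 0 < f x ->
  is_derive x 1 f df -> is_derive x 1 (fun y => ln (f y)) (df / f x).
Proof.
move=> fx hf; apply: (is_derive_eq (is_derive1_comp (is_derive1_ln fx) hf)).
exact: mulrC.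
Qed.

Lemma is_derive1_sum (n : nat) (F : 'I_n -> R -> R) (dF : 'I_n -> R) x :
  (forall i, is_derive x 1 (F i) (dF i)) ->
  is_derive x 1 (fun y => \sum_(i < n) F i y) (\sum_(i < n) dF i).
Proof.
move=> h; have := is_derive_sum h.
by congr (is_derive _ _ _ _); apply/funext => y; rewrite fct_sumE.
Qed.

Lemma mean_value f (df : R -> R) a b : a <= b ->
  (forall x, a <= x <= b -> is_derive x 1 f (df x)) ->
  exists2 c, a <= c <= b & f b - f a = df c * (b - a).
Proof.
move=> ab fd; have [||c cab e] := @MVT_segment R f df a b ab.
- by move=> x; rewrite in_itv/= => /andP[/ltW ax /ltW xb]; apply: fd; rewrite ax.
- apply: derivable_within_continuous => x xab; apply: ex_derive.
  by apply: fd; move: xab; rewrite in_itv.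
by exists c => //; move: cab; rewrite in_itv.
Qed.

(** By the geometric sum, the error of the partial sum has derivative
    [2 * x ^+ n.*2 / (1 - x ^+ 2)], which is nonnegative and increasing in [x]. The mean value
    theorem then gives both bounds. *)
Lemma ln_artanh_bounds (n : nat) t : 0 <= t -> t < 1 ->
  \sum_(k < n) 2 * t ^+ k.*2.+1 / k.*2.+1%:R <= ln (1 + t) - ln (1 - t)
    <= \sum_(k < n) 2 * t ^+ k.*2.+1 / k.*2.+1%:R + 2 * t ^+ n.*2.+1 / (1 - t ^+ 2).
Proof.
move=> t0 t1.
pose f x := ln (1 + x) - ln (1 - x) - \sum_(k < n) 2 * x ^+ k.*2.+1 / k.*2.+1%:R.
pose df x := 2 * x ^+ n.*2 / (1 - x ^+ 2).
have fd x : 0 <= x <= t -> is_derive x 1 f (df x).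
  move=> /andP[x0 xt].
  have x1 : x < 1 by apply: le_lt_trans t1.
  have p1 : 0 < 1 + x by lra.
  have p2 : 0 < 1 - x by lra.
  have h : is_derive x 1 f ((0 + 1) / (1 + x) - (0 - 1) / (1 - x)
      - \sum_(k < n) 2 / k.*2.+1%:R * (k.*2.+1%:R * x ^+ k.*2)).
    have -> : f = fun x => ln (1 + x) - ln (1 - x) -
        \sum_(k < n) 2 / k.*2.+1%:R * x ^+ k.*2.+1.
      by apply/funext => y; congr (_ - _); apply: eq_bigr => k _; rewrite mulrAC.
    apply: is_derive1B; first apply: is_derive1B.
    - by apply: is_derive1_ln_comp => //; apply: is_derive1D.
    - by apply: is_derive1_ln_comp => //; apply: is_derive1B.
    - by apply: is_derive1_sum => k; apply: is_derive1Z; exact: is_derive1X.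
  apply: (is_derive_eq h); rewrite /df /=.
  under eq_bigr do rewrite mulrA divfK ?pnatr_eq0//.
  have geo : (1 - x ^+ 2) * \sum_(k < n) x ^+ k.*2 = 1 - x ^+ n.*2.
    rewrite -muln2 mulnC exprM -[in RHS](expr1n _ n) subrXX; congr (_ * _).
    by apply: eq_bigr => k _; rewrite expr1n mul1r -muln2 mulnC exprM.
  have p3 : 0 < 1 - x ^+ 2 by nra.
  rewrite -mulr_sumr; apply: (mulIf (lt0r_neq0 p3)).
  rewrite divfK ?(lt0r_neq0 p3)//; set S := \sum_(_ < _) _ in geo *.
  have -> : x ^+ n.*2 = 1 - (1 - x ^+ 2) * S by rewrite geo opprB addrC subrK.
  by field; rewrite (lt0r_neq0 p1) (lt0r_neq0 p2).
have [c /andP[c0 ct] e] := mean_value t0 fd.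
have f0 : f 0 = 0.
  by rewrite /f addr0 subr0 ln1 subr0 big1 ?subr0// => k _; rewrite expr0n/= mulr0 mul0r.
rewrite f0 !subr0 in e.
have c2 : 0 < 1 - c ^+ 2 by nra.
have t2 : 0 < 1 - t ^+ 2 by nra.
have dc0 : 0 <= df c by rewrite /df divr_ge0 ?mulr_ge0 ?exprn_ge0// ltW.
have dct : df c <= 2 * t ^+ n.*2 / (1 - t ^+ 2).
  rewrite /df ler_pM ?mulr_ge0 ?exprn_ge0 ?invr_ge0 ?(ltW c2)// ?lef_pV2 ?posrE//.
    by rewrite ler_pM2l// lerXn2r.
  by rewrite lerD2l lerN2 lerXn2r.
have -> : ln (1 + t) - ln (1 - t) = f t + \sum_(k < n) 2 * t ^+ k.*2.+1 / k.*2.+1%:R by rewrite /f subrK.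
rewrite e; apply/andP; split; first by rewrite lerDr mulr_ge0.
by rewrite (addrC (df c * t)) lerD2l exprSr mulrA (mulrAC _ t) ler_wpM2r.
Qed.

Lemma ln_quotient_bounds (n : nat) x t : 0 <= t -> t < 1 -> x * (1 - t) = 1 + t ->
  \sum_(k < n) 2 * t ^+ k.*2.+1 / k.*2.+1%:R <= ln x
    <= \sum_(k < n) 2 * t ^+ k.*2.+1 / k.*2.+1%:R + 2 * t ^+ n.*2.+1 / (1 - t ^+ 2).
Proof.
move=> t0 t1 e; have p1 : 0 < 1 + t by lra.
have p2 : 0 < 1 - t by lra.
have -> : x = (1 + t) / (1 - t) by rewrite -e mulfK// lt0r_neq0.
by rewrite ln_div ?posrE//; exact: ln_artanh_bounds.
Qed.

(* The series of [artanh], with [r] standing for the remainder; the Horner form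
   keeps the fractions small when [lra] evaluates it. *)
Fixpoint artanh_horner (n m : nat) w r : R :=
  if n is n'.+1 then m%:R^-1 + w * artanh_horner n' m.+2 w r else r.

Lemma artanh_hornerE n t r :
  \sum_(k < n) 2 * t ^+ k.*2.+1 / k.*2.+1%:R + 2 * t ^+ n.*2.+1 * r =
  2 * t * artanh_horner n 1 (t ^+ 2) r.
Proof.
suff h m : \sum_(k < n) t ^+ k.*2 / (k.*2 + m)%:R + t ^+ n.*2 * r = artanh_horner n m (t ^+ 2) r.
  rewrite -h mulrDr mulr_sumr exprS !mulrA; congr (_ + _).
  by apply: eq_bigr => k _; rewrite exprS addn1 !mulrA.
elim: n m => [|n IH] m; first by rewrite big_ord0 add0r mul1r.
rewrite big_ord_recl /= mul1r -addrA; congr (_ + _).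
rewrite -IH mulrDr mulr_sumr doubleS !exprSr expr0 mul1r; congr (_ + _); last by ring.
apply: eq_bigr => k _; rewrite /bump/= add1n doubleS !exprSr addSnnS addSnnS; ring.
Qed.

Lemma ln_lower (n : nat) x t : 0 <= t -> t < 1 -> 1 + t <= x * (1 - t) ->
  2 * t * artanh_horner n 1 (t ^+ 2) 0 <= ln x.
Proof.
move=> t0 t1 e; have p : 0 < 1 - t by lra.
have h : (1 + t) / (1 - t) * (1 - t) = 1 + t by rewrite divfK// lt0r_neq0.
have /andP[+ _] := ln_quotient_bounds n t0 t1 h.
rewrite -artanh_hornerE mulr0 addr0 => /le_trans; apply.
have q : 0 < (1 + t) / (1 - t) by rewrite divr_gt0//; lra.
have qx : (1 + t) / (1 - t) <= x by rewrite ler_pdivrMr.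
by rewrite ler_ln ?posrE// (lt_le_trans q).
Qed.

(** For [t <= 1 / 2] the factor [1 / (1 - t ^+ 2)] of the remainder is at most 2; with this constant
    the bound is a polynomial in [t]. *)
Lemma ln_upper (n : nat) x t : 0 < x -> 0 <= t -> t <= 1 / 2 -> x * (1 - t) <= 1 + t ->
  ln x <= 2 * t * artanh_horner n 1 (t ^+ 2) 2.
Proof.
move=> x0 t0 t2 e; have p : 0 < 1 - t by lra.
have t1 : t < 1 by lra.
have h : (1 + t) / (1 - t) * (1 - t) = 1 + t by rewrite divfK// lt0r_neq0.
have /andP[_ b] := ln_quotient_bounds n t0 t1 h.
apply: (@le_trans _ _ (ln ((1 + t) / (1 - t)))).
  by rewrite ler_ln ?posrE ?divr_gt0 ?ler_pdivlMr//; lra.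
rewrite -artanh_hornerE; apply: le_trans b _; rewrite lerD2l ler_pdivrMr; last nra.
have : 0 <= t ^+ n.*2.+1 by exact: exprn_ge0.
set u := t ^+ _ => u0; have w : 0 <= 1 - 2 * t ^+ 2 by nra.
by have := mulr_ge0 u0 w; lra.
Qed.

Lemma ln_diff_ge (x y : R) : 0 < x -> 0 < y -> (y - x) / y <= ln y - ln x.
Proof.
move=> x0 y0; have := @le_ln1Dx R (x / y - 1); rewrite subrKC.
rewrite ln_div ?posrE// ltrBrDr addNr divr_gt0// => /(_ isT).
have -> : (y - x) / y = 1 - x / y by rewrite mulrBl divff// lt0r_neq0.
lra.
Qed.

End Calculus.

(** * The transcendental equation *)

Section SiegelRoot.
Variable R : realType.
Implicit Types nu x : R.

(** The first term of the series at [t = 1 / (2 * nu + 1)], for which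
    [(1 + t) / (1 - t) = (1 + nu) / nu], is already larger than [1 / (1 + nu)]. This is the
    positivity of the derivative of [siegel_fun]. *)
Lemma ln_succ_gap nu : 0 < nu -> (1 + nu)^-1 < ln (1 + nu) - ln nu.
Proof.
move=> nu0; pose t := (2 * nu + 1)^-1.
have p : 0 < 2 * nu + 1 by lra.
have t0 : 0 < t by rewrite invr_gt0.
have t1 : t < 1 by rewrite invf_lt1//; lra.
have e : (1 + nu) / nu * (1 - t) = 1 + t by rewrite /t; field; rewrite !lt0r_neq0.
have /andP[+ _] := ln_quotient_bounds 1 (ltW t0) t1 e.
rewrite ln_div ?posrE//; last lra.
apply: lt_le_trans; rewrite big_ord1 divr1 expr1 /t.
rewrite ltr_pdivlMr// mulrC ltr_pdivrMr; lra.
Qed.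

(* The defining equation of [siegel_root] multiplied by [1 + nu]; in this form
   the left-hand side is increasing on all of ]0, +oo[. *)
Definition siegel_fun (nu : R) : R :=
  (1 + nu) ^+ 2 * (ln (1 + nu) - ln nu) + ln nu - (1 + nu).

Lemma siegel_rootE nu : siegel_root nu <-> 0 < nu /\ siegel_fun nu = 0.
Proof.
suff h : 0 < nu -> ((1 + nu) * ln (1 + nu^-1) + ln nu / (1 + nu) = 1 <-> siegel_fun nu = 0).
  by split=> -[nu0 e]; split=> //; apply/(h nu0).
move=> nu0; have p : 0 < 1 + nu by lra.
have -> : 1 + nu^-1 = (1 + nu) / nu by field; rewrite lt0r_neq0.
rewrite ln_div ?posrE//.
have <- : (1 + nu) * ((1 + nu) * (ln (1 + nu) - ln nu) + ln nu / (1 + nu) - 1)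
   = siegel_fun nu by rewrite /siegel_fun; field; rewrite lt0r_neq0.
split=> [->|/eqP]; first by rewrite subrr mulr0.
by rewrite mulf_eq0 (gt_eqF p)/= subr_eq0 => /eqP.
Qed.

Lemma is_derive_siegel_fun nu : 0 < nu ->
  is_derive nu 1 siegel_fun (2 * (1 + nu) * (ln (1 + nu) - ln nu - (1 + nu)^-1)).
Proof.
move=> nu0; have p : 0 < 1 + nu by lra.
have d1 : is_derive nu 1 (fun x : R => 1 + x) (0 + 1) by exact: is_derive1D.
have dl : is_derive nu 1 (fun x : R => ln x) (1 / nu) by exact: is_derive1_ln_comp.
have dl1 := is_derive1_ln_comp p d1.
have d2 : is_derive nu 1 (fun x : R => (1 + x) ^+ 2) ((0 + 1) * (1 + nu) + (1 + nu) * (0 + 1)).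
  exact: (is_derive1M d1 d1).
have h := is_derive1B (is_derive1D (is_derive1M d2 (is_derive1B dl1 dl)) dl) d1.
by apply: (is_derive_eq h); field; rewrite !lt0r_neq0.
Qed.

Lemma siegel_fun_incr x y : 0 < x -> x < y -> siegel_fun x < siegel_fun y.
Proof.
move=> x0 xy; rewrite -subr_gt0.
have [z|c /andP[xc _] ->] := @mean_value R siegel_fun (fun nu => 2 * (1 + nu) * (ln (1 + nu) - ln nu - (1 + nu)^-1)) _ _ (ltW xy).
  by move=> /andP[xz _]; apply: is_derive_siegel_fun; exact: lt_le_trans xz.
have c0 := lt_le_trans x0 xc.
by rewrite !mulr_gt0 ?subr_gt0 ?ln_succ_gap//; lra.
Qed.

(** The second conclusion unfolds [siegel_value]; the third combines it with the root equation. In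
    terms of [q ^+ 2 = (nu + 1)^-1] they become the hypotheses [ln_scale_eq] and [scale_eq] of the
    later sections. *)
Lemma siegel_root_ln nu : siegel_root nu ->
  [/\ 0 < siegel_value nu,
      ln (siegel_value nu) = 1 - nu * (ln (1 + nu) - ln nu) &
      (nu + 2) * ln (siegel_value nu) = 1 + ln (1 + nu)].
Proof.
move=> h; have [nu0 e] := (siegel_rootE nu).1 h; have p : 0 < 1 + nu by lra.
have s0 : 0 < siegel_value nu.
  by rewrite /siegel_value mulr_gt0 ?expR_gt0// powR_gt0// addr_gt0// invr_gt0.
have es : ln (siegel_value nu) = 1 - nu * (ln (1 + nu) - ln nu).
  rewrite /siegel_value lnM ?posrE ?expR_gt0 ?powR_gt0 ?addr_gt0 ?invr_gt0//.
  rewrite expRK ln_powR.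
  have -> : 1 + nu^-1 = (1 + nu) / nu by field; rewrite lt0r_neq0.
  by rewrite ln_div ?posrE// mulNr.
split=> //; rewrite es; move: e; rewrite /siegel_fun.
set a := ln (1 + nu); set b := ln nu => e.
by apply/eqP; rewrite -subr_eq0; apply/eqP; lra.
Qed.

End SiegelRoot.

(** * Decimal bounds for the root and for the value *)

Section Numerics.
Variable R : realType.

(** A bracket of width [2 / 10 ^+ 7] around the root. Decimals are cut into short groups so that
    every numeral stays small. *)
Let nu_lo : R := 314 / 10 ^+ 3 + 480 / 10 ^+ 6 + 8 / 10 ^+ 7.
Let nu_hi : R := 314 / 10 ^+ 3 + 481 / 10 ^+ 6.

(* In the bounds on [ln x], the argument of the series is [(x - 1) / (x + 1)],
   rounded towards the required side. *)
Lemma ln2_upper : ln 2 <= 693 / 10 ^+ 3 + 147 / 10 ^+ 6 + 210 / 10 ^+ 9 + 600 / 10 ^+ 12 :> R.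
Proof.
by apply: le_trans (@ln_upper R 8 _ (1 / 3) _ _ _ _) _; rewrite ?/artanh_horner; lra.
Qed.

Lemma ln2_lower : 693 / 10 ^+ 3 + 147 / 10 ^+ 6 + 179 / 10 ^+ 9 + 500 / 10 ^+ 12 <= ln 2 :> R.
Proof.
by apply: le_trans (@ln_lower R 8 _ (1 / 3) _ _ _); rewrite ?/artanh_horner; lra.
Qed.

Lemma ln_1nu_lo_lower : 273 / 10 ^+ 3 + 441 / 10 ^+ 6 + 758 / 10 ^+ 9 + 500 / 10 ^+ 12 <= ln (1 + nu_lo) :> R.
Proof.
by apply: le_trans (@ln_lower R 5 _ ((24 * 10 ^+ 3 + 802) / 283 / 645) _ _ _); rewrite ?/artanh_horner /nu_lo; lra.
Qed.

Lemma ln_1nu_lo_upper : ln (1 + nu_lo) <= 273 / 10 ^+ 3 + 441 / 10 ^+ 6 + 760 / 10 ^+ 9 + 500 / 10 ^+ 12 :> R.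
Proof.
by apply: le_trans (@ln_upper R 5 _ ((6 * 10 ^+ 3 + 425) / 213 / 222) _ _ _ _) _; rewrite ?/artanh_horner /nu_lo; lra.
Qed.

Lemma ln_4nu_lo_lower : 229 / 10 ^+ 3 + 462 / 10 ^+ 6 + 106 / 10 ^+ 9 + 500 / 10 ^+ 12 <= ln (4 * nu_lo) :> R.
Proof.
by apply: le_trans (@ln_lower R 5 _ ((14 * 10 ^+ 3 + 189) / 346 / 359) _ _ _); rewrite ?/artanh_horner /nu_lo; lra.
Qed.

Lemma ln_4nu_hi_upper : ln (4 * nu_hi) <= 229 / 10 ^+ 3 + 462 / 10 ^+ 6 + 743 / 10 ^+ 9 + 700 / 10 ^+ 12 :> R.
Proof.
by apply: le_trans (@ln_upper R 5 _ ((7 * 10 ^+ 3 + 283) / 103 / 619) _ _ _ _) _; rewrite ?/artanh_horner /nu_hi; lra.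
Qed.

Lemma ln_1nu_hi_lower : 273 / 10 ^+ 3 + 441 / 10 ^+ 6 + 910 / 10 ^+ 9 + 500 / 10 ^+ 12 <= ln (1 + nu_hi) :> R.
Proof.
by apply: le_trans (@ln_lower R 5 _ ((21 * 10 ^+ 3 + 947) / 393 / 411) _ _ _); rewrite ?/artanh_horner /nu_hi; lra.
Qed.

Lemma ln_1nu_hi_upper : ln (1 + nu_hi) <= 273 / 10 ^+ 3 + 441 / 10 ^+ 6 + 912 / 10 ^+ 9 + 200 / 10 ^+ 12 :> R.
Proof.
by apply: le_trans (@ln_upper R 5 _ ((4 * 10 ^+ 3 + 440) / 41 / 797) _ _ _ _) _; rewrite ?/artanh_horner /nu_hi; lra.
Qed.

Lemma ln_siegel_lo_upper : ln (1 + 733 / 10 ^+ 3 + 610 / 10 ^+ 6 + 5 / 10 ^+ 7) <= 550 / 10 ^+ 3 + 206 / 10 ^+ 6 + 229 / 10 ^+ 9 + 300 / 10 ^+ 12 :> R.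
Proof.
by apply: le_trans (@ln_upper R 8 _ ((20 * 10 ^+ 3 + 204) / 239 / 315) _ _ _ _) _; rewrite ?/artanh_horner; lra.
Qed.

Lemma ln_siegel_hi_lower : 550 / 10 ^+ 3 + 206 / 10 ^+ 6 + 285 / 10 ^+ 9 <= ln (1 + 733 / 10 ^+ 3 + 610 / 10 ^+ 6 + 6 / 10 ^+ 7) :> R.
Proof.
by apply: le_trans (@ln_lower R 8 _ ((8 * 10 ^+ 3 + 555) / 161 / 198) _ _ _); rewrite ?/artanh_horner; lra.
Qed.

(** The series bounds want an argument slightly above 1; the root is near 0.314, and four times it
    is near 1.26. *)
Let ln_quarter (x : R) : 0 < x -> ln x = ln (4 * x) - 2 * ln 2.
Proof.
move=> x0; have -> : 4 * x = 2 * (2 * x) by ring.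
by rewrite !lnM ?posrE ?mulr_gt0//; ring.
Qed.

Lemma siegel_fun_lo : siegel_fun nu_lo < 0.
Proof.
have p : 0 < nu_lo by rewrite /nu_lo; lra.
rewrite /siegel_fun (ln_quarter p).
(* In [siegel_fun] the coefficient of [ln (1 + nu)] is positive and that of [ln nu] is negative;
   these signs decide which bound of each logarithm is taken. *)
move: ln2_upper ln_1nu_lo_upper ln_4nu_lo_lower; rewrite /nu_lo.
by set a := ln _; set b := ln _; set c := ln _ => ha hb hc; lra.
Qed.

Lemma siegel_fun_hi : 0 < siegel_fun nu_hi.
Proof.
have p : 0 < nu_hi by rewrite /nu_hi; lra.
rewrite /siegel_fun (ln_quarter p).
move: ln2_lower ln_1nu_hi_lower ln_4nu_hi_upper; rewrite /nu_hi.
by set a := ln _; set b := ln _; set c := ln _ => ha hb hc; lra.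
Qed.

Lemma siegel_root_exists_unique : exists! nu : R, siegel_root nu.
Proof.
have p : 0 < nu_lo by rewrite /nu_lo; lra.
have lh : nu_lo <= nu_hi by rewrite /nu_lo /nu_hi; lra.
have [||nu] := @IVT R (@siegel_fun R) nu_lo nu_hi 0 lh.
- apply: derivable_within_continuous => x; rewrite in_itv/= => /andP[lx _].
  by apply: ex_derive; apply: is_derive_siegel_fun; exact: lt_le_trans lx.
- by rewrite ge_min le_max (ltW siegel_fun_lo) (ltW siegel_fun_hi) orbT.
rewrite in_itv/= => /andP[l1 _] e; exists nu; split.
  by apply/siegel_rootE; split=> //; exact: lt_le_trans l1.
move=> y /siegel_rootE[y0 ey]; have nu0 := lt_le_trans p l1.
by case: (ltgtP nu y) => // [/(siegel_fun_incr nu0)|/(siegel_fun_incr y0)]; rewrite e ey ltxx.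
Qed.

Lemma siegel_root_bounds (nu : R) : siegel_root nu -> nu_lo < nu < nu_hi.
Proof.
move=> /siegel_rootE[nu0 e]; apply/andP; split; rewrite ltNge; apply/negP.
- rewrite le_eqVlt => /orP[/eqP h|/(siegel_fun_incr nu0)].
    by have := siegel_fun_lo; rewrite -h e ltxx.
  by rewrite e => /lt_trans/(_ siegel_fun_lo); rewrite ltxx.
- have p : 0 < nu_hi by rewrite /nu_hi; lra.
  rewrite le_eqVlt => /orP[/eqP h|/(siegel_fun_incr p)].
    by have := siegel_fun_hi; rewrite h e ltxx.
  by rewrite e => /(lt_trans siegel_fun_hi); rewrite ltxx.
Qed.

(** 3/4 is the slope of [ln (1 + x)] at 1/3, hence a lower bound for it before. It exceeds the value
    0.5502... of [ln (siegel_value nu)], so [1 + ln (1 + nu)] grows faster than [(nu + 2)] times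
    that value, and an inequality between the two need only be checked at an end of the bracket. *)
Lemma ln1D_slope (x y : R) : 0 < x -> x < y -> y <= 1 / 3 ->
  ln (1 + x) + 3 / 4 * (y - x) <= ln (1 + y).
Proof.
move=> x0 xy y3; have p1 : 0 < 1 + x by lra.
have p2 : 0 < 1 + y by lra.
have := ln_diff_ge p1 p2; rewrite (_ : 1 + y - (1 + x) = y - x); last by ring.
have : 3 / 4 * (y - x) <= (y - x) / (1 + y).
  have d0 : 0 <= y - x by lra.
  have w0 : 0 <= 1 / 3 - y by lra.
  by rewrite ler_pdivlMr//; have := mulr_ge0 d0 w0; lra.
by lra.
Qed.

(** The value is computed from [(nu + 2) * ln s = 1 + ln (1 + nu)], where the derivative of [ln s]
    in [nu] is about 0.09. In the defining formula it is about -0.67, and the bracket for [nu] would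
    be too wide for the seventh decimal. *)
Lemma siegel_value_bounds (nu : R) : siegel_root nu ->
  1 + 733 / 10 ^+ 3 + 610 / 10 ^+ 6 + 5 / 10 ^+ 7 <= siegel_value nu
    < 1 + 733 / 10 ^+ 3 + 610 / 10 ^+ 6 + 6 / 10 ^+ 7.
Proof.
have v1 : (1 + 733 / 10 ^+ 3 + 610 / 10 ^+ 6 + 5 / 10 ^+ 7 : R) \is Num.pos by rewrite posrE; lra.
have v2 : (1 + 733 / 10 ^+ 3 + 610 / 10 ^+ 6 + 6 / 10 ^+ 7 : R) \is Num.pos by rewrite posrE; lra.
move=> h; have [+ _ e] := siegel_root_ln h; rewrite -posrE => s0.
have /andP[l u] := siegel_root_bounds h.
have lo0 : 0 < nu_lo by rewrite /nu_lo; lra.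
have hi3 : nu_hi <= 1 / 3 by rewrite /nu_hi; lra.
have nu0 := lt_trans lo0 l.
have q : 0 < nu + 2 by lra.
have c1 := ln1D_slope lo0 l (le_trans (ltW u) hi3).
have c2 := ln1D_slope nu0 u hi3.
apply/andP; split.
- rewrite -(ler_ln v1 s0).
  apply: le_trans ln_siegel_lo_upper _; rewrite -(ler_pM2l q) e.
  apply: le_trans (lerD (lexx 1) c1).
  move: ln_1nu_lo_lower; set a := ln _ => ha; rewrite /nu_lo in l *; lra.
- rewrite -(ltr_ln s0 v2).
  apply: lt_le_trans ln_siegel_hi_lower; rewrite -(ltr_pM2l q) e.
  move: c2 ln_1nu_hi_upper; set a := ln (1 + nu_hi); set b := ln _ => hb ha.
  rewrite /nu_hi in u hb; lra.
Qed.

End Numerics.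

(** * Moments of the extremal density *)

Section CosineSeries.
Variable R : realType.
Implicit Types z t rho : R.

(** The squared modulus of [1 - z e^(it)], the denominator of the Poisson kernel. *)
Definition poisson_den z t : R := 1 - 2 * z * cos t + z ^+ 2.

Lemma poisson_den_lower z t : (1 - `|z|) ^+ 2 <= poisson_den z t.
Proof.
rewrite /poisson_den; have := cos_le1 t; have := cos_geN1 t.
set c := cos t => c1 c2.
have : z * c <= `|z| * 1.
  apply: le_trans (ler_norm _) _; rewrite normrM ler_wpM2l// ler_norml c1; lra.
have : `|z| ^+ 2 = z ^+ 2 by rewrite real_normK// num_real.
by move=> e h; rewrite sqrrB expr1n mul1r e; lra.
Qed.

Lemma poisson_den_gt0 z t : `|z| < 1 -> 0 < poisson_den z t.
Proof.
by move=> z1; apply: lt_le_trans (poisson_den_lower z t); rewrite exprn_gt0// subr_gt0.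
Qed.

Lemma cosSS (k : nat) t : cos (k.+2%:R * t) = 2 * cos t * cos (k.+1%:R * t) - cos (k%:R * t).
Proof.
have -> : k.+2%:R * t = k.+1%:R * t + t by rewrite -[k.+2]addn1 natrD mulrDl mul1r.
have -> : k%:R * t = k.+1%:R * t - t by rewrite -[k.+1]addn1 natrD mulrDl mul1r addrK.
by rewrite cosD cosB; ring.
Qed.

(** The real part of a finite geometric sum of ratio [z e^(it)], cleared of its denominator. *)
Lemma poisson_den_sum (N : nat) z t :
  poisson_den z t * (\sum_(k < N) z ^+ k * cos (k.+1%:R * t)) =
  cos t - z - z ^+ N * cos (N.+1%:R * t) + z ^+ N.+1 * cos (N%:R * t).
Proof.
elim: N => [|N IH]; first by rewrite big_ord0 mulr0 mul0r cos0 expr0 expr1 !mul1r; ring.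
by rewrite big_ord_recr/= mulrDr IH cosSS /poisson_den !exprS; ring.
Qed.

(** With [z] replaced by [z * x], the error vanishes at [x = 0] and has an explicit derivative in
    [x] by [poisson_den_sum]. A single application of the mean value theorem on [0, 1] bounds it
    uniformly in [t]. *)
Lemma ln_poisson_den_approx (N : nat) z t rho : `|z| <= rho -> rho < 1 ->
  `|ln (poisson_den z t) + 2 * \sum_(k < N) z ^+ k.+1 * cos (k.+1%:R * t) / k.+1%:R|
    <= 4 / (1 - rho) ^+ 2 * rho ^+ N.+1.
Proof.
move=> zr r1; have r0 : 0 <= rho by apply: le_trans zr.
pose f x := ln (poisson_den (z * x) t)
  + 2 * \sum_(k < N) (z ^+ k.+1 * cos (k.+1%:R * t) / k.+1%:R) * x ^+ k.+1.
pose df x := z * (2 * (z * x) ^+ N * (z * x * cos (N%:R * t) - cos (N.+1%:R * t))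
  / poisson_den (z * x) t).
have zx (x : R) : 0 <= x <= 1 -> `|z * x| <= rho.
  move=> /andP[x0 x1]; rewrite normrM (ger0_norm x0).
  by apply: le_trans zr; rewrite ler_piMr.
have fd (x : R) : 0 <= x <= 1 -> is_derive x 1 f (df x).
  move=> x01; have D0 : 0 < poisson_den (z * x) t.
    by apply: poisson_den_gt0; exact: le_lt_trans (zx _ x01) r1.
  have d1 : is_derive x 1 (fun y => poisson_den (z * y) t) (- (2 * z * cos t) + 2 * z ^+ 2 * x).
    have -> : (fun y => poisson_den (z * y) t) = fun y => 1 - (2 * z * cos t) * y + z ^+ 2 * y ^+ 2.
      by apply/funext => y; rewrite /poisson_den; ring.
    have h := is_derive1D (is_derive1B (is_derive1_cst 1 x)
      (is_derive1Z (2 * z * cos t) (is_derive1_id x))) (is_derive1Z (z ^+ 2) (is_derive1X 2 x)).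
    by apply: (is_derive_eq h) => /=; ring.
  have h := is_derive1D (@is_derive1_ln_comp R (fun y => poisson_den (z * y) t) x _ D0 d1)
    (is_derive1Z 2 (is_derive1_sum (fun k : 'I_N =>
      is_derive1Z (z ^+ k.+1 * cos (k.+1%:R * t) / k.+1%:R) (is_derive1X k.+1 x)))).
  apply: (is_derive_eq h); rewrite /df /=.
  have -> : \sum_(k < N) z ^+ k.+1 * cos (k.+1%:R * t) / k.+1%:R * (k.+1%:R * x ^+ k)
      = z * \sum_(k < N) (z * x) ^+ k * cos (k.+1%:R * t).
    rewrite mulr_sumr; apply: eq_bigr => k _; rewrite exprMn exprS.
    by field; rewrite nat1r pnatr_eq0.
  have := poisson_den_sum N (z * x) t; set S := \sum_(_ < _) _ => e.
  apply: (mulIf (lt0r_neq0 D0)); rewrite mulrDl !(divfK (lt0r_neq0 D0)) mulrA.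
  rewrite -[X in _ + X]mulrA (mulrC S) -mulrA e [in RHS]mulrA (divfK (lt0r_neq0 D0)) !exprS.
  ring.
have [c c01 e] := mean_value ler01 fd.
have -> : ln (poisson_den z t) + 2 * \sum_(k < N) z ^+ k.+1 * cos (k.+1%:R * t) / k.+1%:R = f 1.
  rewrite /f mulr1; congr (_ + 2 * _); apply: eq_bigr => k _; by rewrite expr1n mulr1.
have f0 : f 0 = 0.
  rewrite /f /poisson_den mulr0 mulr0 mul0r subr0 expr0n/= addr0 ln1 add0r.
  by rewrite big1 ?mulr0// => k _; rewrite expr0n mulr0.
move: e; rewrite f0 !subr0 mulr1 => ->; rewrite /df.
have zc := zx _ c01; have nr1 : `|z * c| < 1 by exact: le_lt_trans zc r1.
have D0 := poisson_den_gt0 t nr1.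
rewrite !normrM normfV (gtr0_norm D0) normrX (ger0_norm (ler0n R 2)).
have h1 : `|z * c * cos (N%:R * t) - cos (N.+1%:R * t)| <= 2.
  apply: le_trans (ler_normB _ _) _; rewrite normrM.
  have b (x : R) : `|cos x| <= 1 :> R by rewrite ler_norml cos_geN1 cos_le1.
  have := b (N%:R * t); have := b (N.+1%:R * t).
  have : `|z * c| * `|cos (N%:R * t)| <= 1 * 1 by rewrite ler_pM// ltW.
  by lra.
have h2 : (poisson_den (z * c) t)^-1 <= ((1 - rho) ^+ 2)^-1.
  rewrite lef_pV2 ?posrE ?exprn_gt0 ?subr_gt0//.
  apply: le_trans (poisson_den_lower _ _); rewrite lerXn2r ?nnegrE ?subr_ge0 ?(ltW r1)//.
    by rewrite (le_trans zc)// ltW.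
  by rewrite lerB.
have -> : 4 / (1 - rho) ^+ 2 * rho ^+ N.+1 = rho * ((2 * rho ^+ N * 2) / (1 - rho) ^+ 2).
  by rewrite [rho ^+ N.+1]exprS; ring.
apply: ler_pM => //; first by rewrite !mulr_ge0 ?exprn_ge0 ?invr_ge0 ?(ltW D0).
apply: ler_pM => //; rewrite ?invr_ge0 ?(ltW D0)// ?mulr_ge0 ?exprn_ge0//.
by apply: ler_pM; rewrite ?mulr_ge0 ?exprn_ge0// ler_pM2l// lerXn2r ?nnegrE.
Qed.

(** Lets an identity be proved from truncations of every order: its defect lies below each term of a
    geometric sequence. *)
Lemma le_geometric_eq0 (A C rho : R) : 0 <= rho -> rho < 1 ->
  (forall N : nat, `|A| <= C * rho ^+ N) -> A = 0.
Proof.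
move=> r0 r1 h; apply/eqP; rewrite -normr_le0.
have : (fun N => C * rho ^+ N) @ \oo --> C * 0.
  by apply: cvgM; [exact: cvg_cst|apply: cvg_expr; rewrite ger0_norm].
rewrite mulr0 => cv; rewrite -(cvg_lim (@Rhausdorff R) cv).
by apply: limr_ge; [apply/cvg_ex; exists 0|apply: nearW].
Qed.

End CosineSeries.

Section IntegralOnSegment.
Variable R : realType.
Local Notation leb := (@lebesgue_measure R).
Implicit Types (f g F : R -> R) (a b : R).

Lemma continuous_integrable_itv f a b :
  {within `[a, b], continuous f} -> leb.-integrable `[a, b] (EFin \o f).
Proof. by move=> cf; apply: continuous_compact_integrable => //; exact: segment_compact. Qed.

Lemma continuous_integrable f a b :
  continuous f -> leb.-integrable `[a, b] (EFin \o f).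
Proof. by move=> cf; apply: continuous_integrable_itv; exact: continuous_subspaceT. Qed.

Lemma Rintegral_derive f F a b : a < b -> continuous f ->
  (forall x : R, is_derive x 1 F (f x)) -> \int[leb]_(x in `[a, b]) f x = F b - F a.
Proof.
move=> ab cf dF; rewrite /Rintegral (@continuous_FTC2 R f F a b ab)//.
- exact: continuous_subspaceT.
- split; first by move=> x _; exact: (@ex_derive _ _ _ _ _ _ _ (dF x)).
  + by apply: cvg_at_right_filter; exact: is_derive_continuous (dF a).
  + by apply: cvg_at_left_filter; exact: is_derive_continuous (dF b).
- by move=> x _; rewrite derive1E; exact: (@derive_val _ _ _ _ _ _ _ (dF x)).
Qed.

Lemma continuous_lin_comp g (u v : R) : continuous g -> continuous (fun t => g (u * t + v)).
Proof.
move=> cg t; apply: (@continuous_comp _ _ _ (fun t => u * t + v) g); last exact: cg.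
by apply: cvgD; [apply: cvgM; [exact: cvg_cst|exact: cvg_id]|exact: cvg_cst].
Qed.

Lemma continuous_cos_mul (k : nat) : continuous (fun t : R => cos (k%:R * t)).
Proof.
have -> : (fun t : R => cos (k%:R * t)) = (fun t => cos (k%:R * t + 0)).
  by apply/funext => t; rewrite addr0.
by apply: continuous_lin_comp => t; exact: continuous_cos.
Qed.

Lemma Rintegral_cos_mul (k : nat) : \int[leb]_(t in `[0, pi]) cos (k%:R * t) = pi *+ (k == 0%N) :> R.
Proof.
have [->|k0] := eqVneq k 0%N.
  transitivity (\int[leb]_(t in `[0, (pi : R)]) (1 : R)).
    by apply: eq_Rintegral => t _; rewrite mul0r cos0.
  rewrite Rintegral_cst//= mul1r lebesgue_measure_itv/=.
  by rewrite lte_fin pi_gt0 oppr0 adde0 mulr1n.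
have kr : k%:R != 0 :> R by rewrite pnatr_eq0.
have dF (x : R) : is_derive x 1 (fun t => k%:R^-1 * sin (k%:R * t)) (cos (k%:R * x)).
  have h := is_derive1Z k%:R^-1 (@is_derive1_comp R sin (fun t => k%:R * t) x _ _
    (is_derive_sin _) (is_derive1Z k%:R (is_derive1_id x))).
  by apply: (is_derive_eq h); rewrite mulr1 mulrCA mulVf// mulr1.
rewrite (Rintegral_derive (pi_gt0 R) (@continuous_cos_mul k) dF).
rewrite mulr0 sin0 mulr0 subr0 mulr0n.
suff -> : sin (k%:R * pi) = 0 :> R by rewrite mulr0.
elim: k {k0 kr dF} => [|k IH]; first by rewrite mul0r sin0.
by rewrite -addn1 natrD mulrDl mul1r sinDpi IH oppr0.
Qed.

End IntegralOnSegment.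

(** * Cosine moments and logarithmic integrals of the angle weight *)

Section Moments.
Variable R : realType.
Local Notation leb := (@lebesgue_measure R).
Variable q : R.
Hypotheses (q0 : 0 < q) (q1 : q < 1).

(* The extremal measure in the variable [t], where
   [x = s * (1 + q ^+ 2 + 2 * q * cos t)]. *)
Definition angle_weight (t : R) : R := 2 / pi * sin t ^+ 2 / poisson_den (- q) t.

Definition angle_int (g : R -> R) : R :=
  \int[leb]_(t in `[0, pi]) (g t * angle_weight t).

Let nq1 : `|- q| < 1. Proof. by rewrite normrN gtr0_norm. Qed.

Lemma angle_weight_ge0 t : 0 <= angle_weight t.
Proof.
by rewrite /angle_weight divr_ge0 ?(ltW (poisson_den_gt0 _ nq1))// mulr_ge0 ?sqr_ge0// divr_ge0// pi_ge0.
Qed.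

Lemma continuous_poisson_den (z : R) : continuous (poisson_den z).
Proof.
move=> t; apply: cvgD; last exact: cvg_cst.
apply: cvgB; first exact: cvg_cst.
by apply: cvgM; [exact: cvg_cst|exact: continuous_cos].
Qed.

Lemma continuous_angle_weight : continuous angle_weight.
Proof.
move=> t; apply: cvgM.
  apply: cvgM; first exact: cvg_cst.
  by rewrite expr2; apply: cvgM; exact: continuous_sin.
by apply: cvgV; [rewrite gt_eqF// poisson_den_gt0|exact: continuous_poisson_den].
Qed.

Lemma angle_integrable (g : R -> R) : continuous g ->
  leb.-integrable `[0, pi] (EFin \o (fun t => g t * angle_weight t)).
Proof.
move=> cg; apply: continuous_integrable => t.
by apply: cvgM; [exact: cg|exact: continuous_angle_weight].
Qed.

Lemma angle_intD (f g : R -> R) : continuous f -> continuous g ->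
  angle_int (fun t => f t + g t) = angle_int f + angle_int g.
Proof.
move=> cf cg; rewrite /angle_int -RintegralD//; try exact: angle_integrable.
by apply: eq_Rintegral => t _; rewrite mulrDl.
Qed.

Lemma angle_intZ c (f : R -> R) : continuous f ->
  angle_int (fun t => c * f t) = c * angle_int f.
Proof.
move=> cf; rewrite /angle_int -RintegralZl//; try exact: angle_integrable.
by apply: eq_Rintegral => t _; rewrite mulrA.
Qed.

Lemma angle_int_sum (N : nat) (F : nat -> R -> R) : (forall k, continuous (F k)) ->
  continuous (fun t => \sum_(k < N) F k t) /\
  angle_int (fun t => \sum_(k < N) F k t) = \sum_(k < N) angle_int (F k).
Proof.
move=> cF; elim: N => [|N [IHc IH]].
  have -> : (fun t => \sum_(k < 0) F k t) = cst 0 by apply/funext => t; rewrite big_ord0.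
  split; first by move=> t; exact: cvg_cst.
  rewrite big_ord0 /angle_int.
  transitivity (\int[leb]_(t in `[0, (pi : R)]) (0 : R)).
    by apply: eq_Rintegral => t _; rewrite mul0r.
  by rewrite Rintegral_cst//= mul0r.
have -> : (fun t => \sum_(k < N.+1) F k t) = (fun t => \sum_(k < N) F k t + F N t).
  by apply/funext => t; rewrite big_ord_recr.
split; first by move=> t; apply: cvgD; [exact: IHc|exact: cF].
by rewrite angle_intD// IH big_ord_recr.
Qed.

Lemma angle_int_norm_le (f : R -> R) (C : R) : continuous f ->
  (forall t, `|f t| <= C) -> `|angle_int f| <= C * angle_int (cst 1).
Proof.
move=> cf fC; rewrite -angle_intZ; last by move=> t; exact: cvg_cst.
apply: le_trans (le_normr_Rintegral _ (angle_integrable cf)) _ => //.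
apply: le_Rintegral => //.
- by have := integrable_norm (angle_integrable cf).
- by apply: (angle_integrable (g := fun=> C * 1)) => t; exact: cvg_cst.
- move=> t _; rewrite normrM (ger0_norm (angle_weight_ge0 t)) mulr1.
  by rewrite ler_wpM2r ?angle_weight_ge0.
Qed.

Definition cos_moment (k : nat) : R := angle_int (fun t => cos (k%:R * t)).

Lemma cos_moment_norm_le k : `|cos_moment k| <= angle_int (cst 1).
Proof.
rewrite -[leRHS]mul1r; apply: angle_int_norm_le; first exact: continuous_cos_mul.
by move=> t; rewrite ler_norml cos_geN1 cos_le1.
Qed.

Lemma cos_moment0 : cos_moment 0 = angle_int (cst 1).
Proof. by congr angle_int; apply/funext => t; rewrite mul0r cos0. Qed.

(** Multiplying by [1 + q ^+ 2 + 2 * q * cos t] cancels the denominator of [angle_weight]. For [f] a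
    cosine this becomes the recurrence of the moments. *)
Lemma angle_int_den (f : R -> R) : continuous f ->
  (1 + q ^+ 2) * angle_int f + 2 * q * angle_int (fun t => cos t * f t) =
  2 / pi * \int[leb]_(t in `[0, pi]) (sin t ^+ 2 * f t).
Proof.
move=> cf.
have c1 : continuous (fun t => cos t * f t).
  by move=> t; apply: cvgM; [exact: continuous_cos|exact: cf].
have c2 : continuous (fun t => sin t ^+ 2 * f t).
  by move=> t; apply: cvgM; [rewrite expr2; apply: cvgM; exact: continuous_sin|exact: cf].
rewrite -!angle_intZ// -angle_intD; last 2 first.
- by move=> t; apply: cvgM; [exact: cvg_cst|exact: cf].
- by move=> t; apply: cvgM; [exact: cvg_cst|exact: c1].
rewrite -RintegralZl//; last exact: continuous_integrable.
apply: eq_Rintegral => t _; rewrite /angle_weight.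
have := poisson_den_gt0 t nq1; set D := poisson_den _ _ => D0.
have -> : (1 + q ^+ 2) * f t + 2 * q * (cos t * f t) = D * f t.
  by rewrite /D /poisson_den; ring.
by move: (pi : R) (pi_gt0 R) => P P0; field; rewrite !lt0r_neq0.
Qed.

Lemma Rintegral_sin2_cos (k : nat) :
  2 / pi * \int[leb]_(t in `[0, pi]) (sin t ^+ 2 * cos (k%:R * t)) = (k == 0%N)%:R - (k == 2)%:R / 2 :> R.
Proof.
have ci (j : nat) := @continuous_integrable R _ 0 pi (@continuous_cos_mul R j).
have ciZ (c : R) (j : nat) : leb.-integrable `[0, pi] (EFin \o (fun t => c * cos (j%:R * t))).
  by apply: continuous_integrable => t; apply: cvgM; [exact: cvg_cst|exact: continuous_cos_mul].
have ciB (c d : R) (i j : nat) : leb.-integrable `[0, pi] (EFin \o (fun t => c * cos (i%:R * t) - d * cos (j%:R * t))).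
  by apply: continuous_integrable => t; apply: cvgB; (apply: cvgM; [exact: cvg_cst|exact: continuous_cos_mul]).
(* The product formula produces the frequencies [k], [k + 2] and [|k - 2|]; the witness [j] is the
   last one, which vanishes only for [k = 2]. *)
have [j e] : exists j : nat, forall t : R, sin t ^+ 2 * cos (k%:R * t) =
    (1 / 2 * cos (k%:R * t) - 1 / 4 * cos (k.+2%:R * t)) - 1 / 4 * cos (j%:R * t) /\ ((j == 0%N) = (k == 2)).
  have s2 t : sin t ^+ 2 = 1 - cos t ^+ 2 :> R by rewrite -(cos2Dsin2 t) addrC addKr.
  have C0 t : cos (0%:R * t) = 1 :> R by rewrite mul0r cos0.
  have C1 t : cos (1%:R * t) = cos t :> R by rewrite mul1r.
  case: k => [|[|k]].
  - by exists 2%N => t; split=> //; rewrite s2 (cosSS 0) C0 C1; field.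
  - by exists 1%N => t; split=> //; rewrite s2 (cosSS 1) (cosSS 0) C0 C1; field.
  - exists k => t; split=> //.
    by rewrite s2 (cosSS k.+2) (cosSS k.+1) (cosSS k); field.
have jk := (e 0).2; have e' t := (e t).1.
under eq_Rintegral do rewrite e'.
rewrite RintegralB// RintegralB//.
rewrite !RintegralZl// !Rintegral_cos_mul -jk /=.
move: (pi : R) (pi_gt0 R) => P P0.
by case: (k == 0%N); case: (j == 0%N); rewrite /= ?mulr0n ?mulr1n; field; rewrite lt0r_neq0.
Qed.

Lemma cos_moment_rec (k : nat) :
  (1 + q ^+ 2) * cos_moment k.+1 + q * (cos_moment k + cos_moment k.+2) = - (k.+1 == 2)%:R / 2.
Proof.
have := angle_int_den (@continuous_cos_mul R k.+1).
rewrite Rintegral_sin2_cos sub0r -mulNr => <-; congr (_ + _).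
rewrite -angle_intD; try exact: continuous_cos_mul.
rewrite [in RHS](mulrC 2) -[in RHS]mulrA; congr (_ * _).
rewrite -angle_intZ; last by move=> t; apply: cvgM; [exact: continuous_cos|exact: continuous_cos_mul].
by congr angle_int; apply/funext => t; rewrite cosSS; ring.
Qed.

Lemma cos_moment_rec0 : (1 + q ^+ 2) * cos_moment 0 + 2 * q * cos_moment 1 = 1.
Proof.
have := angle_int_den (@continuous_cos_mul R 0).
rewrite Rintegral_sin2_cos /= mul0r subr0; apply: etrans; congr (_ + _ * _).
by congr angle_int; apply/funext => t; rewrite mul0r cos0 mulr1 mul1r.
Qed.

(* The recurrence has the characteristic roots [- q] and [- q^-1]; boundedness
   of the moments leaves only the first one. *)
Lemma cos_moment_geometric (k : nat) : (2 <= k)%N -> cos_moment k.+1 = - q * cos_moment k.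
Proof.
move=> k2; pose n j := cos_moment j.+1 + q * cos_moment j.
suff : n k = 0 by rewrite /n mulNr => /eqP; rewrite addr_eq0 => /eqP.
have step (j : nat) : (2 <= j)%N -> n j = - q * n j.+1.
  move=> j2; have := cos_moment_rec j; rewrite eqSS gtn_eqF// oppr0 mul0r /n => e.
  by apply/eqP; rewrite -subr_eq0 -e; apply/eqP; ring.
have it (N j : nat) : (2 <= j)%N -> n j = (- q) ^+ N * n (j + N)%N.
  move=> j2; elim: N => [|N IH]; first by rewrite expr0 mul1r addn0.
  by rewrite IH step ?(leq_trans j2 (leq_addr _ _))// addnS exprSr mulrA.
apply: (@le_geometric_eq0 R _ (2 * cos_moment 0) q) => // [|N]; first exact: ltW.
rewrite (it N k k2) normrM normrX normrN (gtr0_norm q0) mulrC ler_wpM2r ?exprn_ge0 ?(ltW q0)//.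
apply: le_trans (ler_normD _ _) _; rewrite normrM (gtr0_norm q0).
have h1 := cos_moment_norm_le (k + N).+1; have h2 := cos_moment_norm_le (k + N).
rewrite -cos_moment0 in h1 h2.
have : q * `|cos_moment (k + N)| <= 1 * cos_moment 0 by apply: ler_pM => //; exact: ltW.
lra.
Qed.

Lemma cos_moment_values :
  [/\ cos_moment 0 = 1, cos_moment 1 = - q / 2 & forall k, cos_moment k.+2 = - (1 - q ^+ 2) / 2 * (- q) ^+ k].
Proof.
(* The third moment being [- q] times the second, the recurrences at 1, at 0 and [cos_moment_rec0]
   form a closed system for the moments 0, 1 and 2. *)
have g := cos_moment_geometric (leqnn 2).
have r2 := cos_moment_rec 1; have r1 := cos_moment_rec 0; have r0 := cos_moment_rec0.
rewrite /= in r1 r2.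
have n1 : cos_moment 2 + q * cos_moment 1 = - (1 / 2).
  rewrite g in r2; rewrite -[RHS](mulr1 _).
  by rewrite mulr1 -[RHS]/(- (1 / 2)); move: r2; set x := cos_moment 2; set y := cos_moment 1 => r2; lra.
have n0 : cos_moment 1 = q / 2 - q * cos_moment 0.
  have : q * (cos_moment 2 + q * cos_moment 1) + (cos_moment 1 + q * cos_moment 0) = 0 by move: r1; rewrite oppr0 mul0r => <-; ring.
  by rewrite n1; lra.
have m0 : cos_moment 0 = 1.
  have q2 : 1 - q ^+ 2 != 0 by rewrite subr_eq0 eq_sym lt_eqF// expr_lt1// ltW.
  apply/eqP; rewrite -subr_eq0 -(mulIr_eq0 _ (mulIf q2)); apply/eqP.
  by transitivity ((1 + q ^+ 2) * cos_moment 0 + 2 * q * cos_moment 1 - 1); [rewrite n0; field|rewrite r0 subrr].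
have m1 : cos_moment 1 = - q / 2 by rewrite n0 m0; lra.
have m2 : cos_moment 2 = - (1 - q ^+ 2) / 2 by move: n1; rewrite m1; nra.
split=> //; elim=> [|k IH]; first by rewrite expr0 mulr1.
by rewrite cos_moment_geometric// IH [(- q) ^+ k.+1]exprS; ring.
Qed.

Lemma angle_int_cst c : angle_int (cst c) = c.
Proof.
have -> : cst c = (fun t : R => c * cst 1 t) by apply/funext => t; rewrite mulr1.
rewrite angle_intZ; last by move=> t; exact: cvg_cst.
by rewrite -cos_moment0; have [-> _ _] := cos_moment_values; rewrite mulr1.
Qed.

Lemma continuous_ln_poisson_den z v : `|z| < 1 -> continuous (fun t : R => ln (poisson_den z (t + v))).
Proof.
move=> z1.
have c : continuous (fun t : R => ln (poisson_den z t)).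
  move=> t; apply: (@continuous_comp _ _ _ (poisson_den z) (@ln R)).
    exact: continuous_poisson_den.
  by apply: continuous_ln; exact: poisson_den_gt0.
move=> t; have := @continuous_lin_comp R _ 1 v c t.
by congr continuous_at; apply/funext => x; rewrite mul1r.
Qed.

(** Adding the arguments [t - v] and [t + v] leaves only products [cos (k t) cos (k v)], so each
    term of the expansion integrates to a cosine moment. From frequency 2 on the moments are
    geometric of ratio [- q], and the series resums to a logarithm at [- q * z]. Frequency 1
    deviates from this pattern, and its excess is the term [2 * z * cos v / q]. *)
Lemma angle_int_ln_poisson (z v : R) : `|z| < 1 ->
  angle_int (fun t => ln (poisson_den z (t - v)) + ln (poisson_den z (t + v))) =
  2 * z * cos v / q - (1 - q ^+ 2) / q ^+ 2 * ln (poisson_den (- q * z) v).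
Proof.
move=> z1; pose rho : R := `|z|; have rho0 : 0 <= rho by rewrite normr_ge0.
pose nu : R := (1 - q ^+ 2) / q ^+ 2.
have qz : `|- q * z| <= rho by rewrite normrM normrN (gtr0_norm q0) ler_piMl// ltW.
have nu0 : 0 <= nu by rewrite divr_ge0 ?sqr_ge0// subr_ge0 expr_le1// ltW.
pose C : R := 4 / (1 - rho) ^+ 2.
have C0 : 0 <= C by rewrite divr_ge0 ?sqr_ge0.
apply/eqP; rewrite -subr_eq0; apply/eqP.
apply: (@le_geometric_eq0 R _ ((2 * C + nu * C) * rho ^+ 2) rho) => // N.
pose a (k : nat) := 4 * z ^+ k.+1 * cos (k.+1%:R * v) / k.+1%:R.
pose S (t : R) : R := \sum_(k < N.+1) a k * cos (k.+1%:R * t).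
pose L (t : R) : R := ln (poisson_den z (t - v)) + ln (poisson_den z (t + v)).
have cF k : continuous (fun t : R => a k * cos (k.+1%:R * t)).
  by move=> t; apply: cvgM; [exact: cvg_cst|exact: continuous_cos_mul].
have [cS eS] := angle_int_sum N.+1 cF.
have cL : continuous L.
  by move=> t; apply: cvgD; exact: continuous_ln_poisson_den.
have LS (t : R) : `|L t + S t| <= 2 * C * rho ^+ N.+2.
  have h1 := ln_poisson_den_approx N.+1 (t - v) (lexx rho) z1.
  have h2 := ln_poisson_den_approx N.+1 (t + v) (lexx rho) z1.
  have -> : L t + S t =
      (ln (poisson_den z (t - v)) + 2 * \sum_(k < N.+1) z ^+ k.+1 * cos (k.+1%:R * (t - v)) / k.+1%:R)
    + (ln (poisson_den z (t + v)) + 2 * \sum_(k < N.+1) z ^+ k.+1 * cos (k.+1%:R * (t + v)) / k.+1%:R).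
    rewrite addrACA -mulrDr -big_split/= mulr_sumr; congr (_ + _); apply: eq_bigr => k _.
    by rewrite (mulrBr k.+1%:R) (mulrDr k.+1%:R) cosB cosD /a; ring.
  by apply: le_trans (ler_normD _ _) _; rewrite /C; move: h1 h2; lra.
have h1 : `|angle_int L + angle_int S| <= 2 * C * rho ^+ N.+2.
  rewrite -angle_intD//; have -> : 2 * C * rho ^+ N.+2 = 2 * C * rho ^+ N.+2 * angle_int (cst 1).
    by rewrite angle_int_cst mulr1.
  by apply: angle_int_norm_le => // t; apply: cvgD; [exact: cL|exact: cS].
have [m0 m1 m2] := cos_moment_values.
have eS' : angle_int S = - (2 * z * cos v / q)
    - nu * (2 * \sum_(k < N.+1) (- q * z) ^+ k.+1 * cos (k.+1%:R * v) / k.+1%:R).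
  rewrite [LHS]eS !big_ord_recl/= mulrDr mulrDr opprD addrA; congr (_ + _).
    rewrite angle_intZ; last exact: continuous_cos_mul.
    by rewrite -/(cos_moment 1) m1 /a /nu !expr1 !mul1r; field; rewrite lt0r_neq0.
  rewrite !mulr_sumr -sumrN; apply: eq_bigr => k _.
  rewrite angle_intZ; last exact: continuous_cos_mul.
  rewrite /bump/= add1n -/(cos_moment k.+2) m2 /a /nu exprMn.
  have -> : (- q) ^+ k.+2 = (- q) ^+ k * q ^+ 2 by rewrite -[k.+2]addn2 exprD sqrrN.
  have k2 : k.+2%:R != 0 :> R by rewrite pnatr_eq0.
  move: (cos (_ * v)) => X; move: (k.+2%:R) k2 => K K0.
  by field; rewrite K0 lt0r_neq0.
have h2 := ln_poisson_den_approx N.+1 v qz z1.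
have -> : angle_int L - (2 * z * cos v / q - nu * ln (poisson_den (- q * z) v)) =
   (angle_int L + angle_int S) + nu * (ln (poisson_den (- q * z) v) +
    2 * \sum_(k < N.+1) (- q * z) ^+ k.+1 * cos (k.+1%:R * v) / k.+1%:R).
  by rewrite eS'; ring.
apply: le_trans (ler_normD _ _) _; rewrite (normrM nu) (ger0_norm nu0).
have -> : (2 * C + nu * C) * rho ^+ 2 * rho ^+ N = 2 * C * rho ^+ N.+2 + nu * (C * rho ^+ N.+2).
  by rewrite -[N.+2]addn2 exprD; ring.
by apply: lerD => //; rewrite ler_wpM2l.
Qed.

End Moments.

(** * Positivity of the logarithmic energy *)

Section PositiveKernel.
Local Open Scope ereal_scope.
Context d d' (W : measurableType d) (X : measurableType d') (R : realType).
Variable lam : {sigma_finite_measure set W -> \bar R}.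
Variables (phi : W * X -> \bar R) (w : W -> \bar R).
Hypotheses (mphi : measurable_fun setT phi) (phi0 : forall z, 0 <= phi z).
Hypotheses (mw : measurable_fun setT w) (w0 : forall o, 0 <= w o).
Implicit Types mu nu : probability X R.

Definition smear mu (o : W) : \bar R := \int[mu]_x phi (o, x).

Lemma measurable_smear mu : measurable_fun setT (smear mu).
Proof. exact: (measurable_fun_fubini_tonelli_F phi). Qed.

Lemma smear_ge0 mu o : 0 <= smear mu o.
Proof. exact: integral_ge0. Qed.

Let mphil (x : X) : measurable_fun setT (fun o => phi (o, x)).
Proof. exact: (measurableT_comp mphi (pair2_measurable x)). Qed.

Let mphir (o : W) : measurable_fun setT (fun x => phi (o, x)).
Proof. exact: (measurableT_comp mphi (pair1_measurable o)). Qed.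

(** The kernel is a mixture of rank one kernels, so exchanging the integrals gives a weighted
    integral of products. This is the source of positivity: for equal measures the integrand is a
    weighted square. *)
Lemma smear_energy mu nu :
  \int[mu]_x \int[nu]_y \int[lam]_o (phi (o, x) * phi (o, y) * w o) =
  \int[lam]_o (smear mu o * smear nu o * w o).
Proof.
have inner x : \int[nu]_y \int[lam]_o (phi (o, x) * phi (o, y) * w o) =
    \int[lam]_o (phi (o, x) * (smear nu o * w o)).
  rewrite (fubini_tonelli (m1 := nu) (m2 := lam)
    (fun z => phi (z.2, x) * phi (z.2, z.1) * w z.2))/=; last 2 first.
  - apply: emeasurable_funM; last exact: measurableT_comp.
    apply: emeasurable_funM; first exact: (measurableT_comp (mphil x)).
    by apply: (measurableT_comp mphi); exact: measurable_swap.
  - by move=> z; rewrite !mule_ge0.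
  apply: eq_integral => o _.
  under eq_integral do rewrite -muleA (muleC (phi _) (w o)) muleA.
  rewrite ge0_integralZl//; last by rewrite mule_ge0.
  by rewrite -muleA [w o * _]muleC.
under eq_integral do rewrite inner.
rewrite (fubini_tonelli (m1 := mu) (m2 := lam)
    (fun z => phi (z.2, z.1) * (smear nu z.2 * w z.2)))/=; last 2 first.
- apply: emeasurable_funM; first by apply: (measurableT_comp mphi); exact: measurable_swap.
  apply: (measurableT_comp (f := fun o => smear nu o * w o)) => //.
  by apply: emeasurable_funM => //; exact: measurable_smear.
- by move=> z; rewrite !mule_ge0 ?smear_ge0.
apply: eq_integral => o _.
by rewrite ge0_integralZr// ?mule_ge0 ?smear_ge0// muleA.
Qed.

End PositiveKernel.

Section FTCSegment.
Variable R : realType.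
Local Notation leb := (@lebesgue_measure R).

Lemma integral_derive (f F : R -> R) (a b : R) : a < b ->
  (forall x, a <= x <= b -> {for x, continuous f}) ->
  (forall x, a <= x <= b -> is_derive x 1 F (f x)) ->
  (\int[leb]_(x in `[a, b]) (f x)%:E = (F b - F a)%:E)%E.
Proof.
move=> ab cf dF.
have aab : a <= a <= b by rewrite lexx ltW.
have bab : a <= b <= b by rewrite lexx ltW.
rewrite (@continuous_FTC2 R f F a b ab)//.
- by apply: continuous_in_subspaceT => x; rewrite inE/= in_itv/=; exact: cf.
- split; first by move=> x; rewrite in_itv/= => /andP[/ltW ax /ltW xb]; apply: (@ex_derive _ _ _ _ _ _ _ (dF x _)); rewrite ax.
  + by apply: cvg_at_right_filter; exact: is_derive_continuous (dF a aab).
  + by apply: cvg_at_left_filter; exact: is_derive_continuous (dF b bab).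
- move=> x; rewrite in_itv/= => /andP[/ltW ax /ltW xb]; rewrite derive1E.
  by apply: (@derive_val _ _ _ _ _ _ _ (dF x _)); rewrite ax.
Qed.

End FTCSegment.

Section LogKernel.
Variable R : realType.
Local Notation leb := (@lebesgue_measure R).
Local Notation RR := (measurableTypeR R).
Implicit Types (x y r s T : R).

(* [- ln r] is, up to an error controlled by [r / T], the mixture
   [\int_0^T max(0, s - r) s^-2 ds] of hat functions, and
   [max(0, s - |x - y|)] is the measure of the set of [u] such that both [x] and
   [y] belong to [`]u, u + s]]. *)
Definition hat_weight T s : R := if 0 < s <= T then s ^- 2 else 0.

Definition hat_mix T r : \bar R :=
  (\int[leb]_s (hat_weight T s * Num.max 0 (s - r))%:E)%E.

Lemma hat_weight_ge0 T s : 0 <= hat_weight T s.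
Proof. by rewrite /hat_weight; case: ifPn => // _; rewrite invr_ge0 sqr_ge0. Qed.

Lemma measurable_hat_weight T : measurable_fun setT (hat_weight T : RR -> RR).
Proof.
have -> : (hat_weight T : RR -> RR) = fun s => if 0 < s <= T then expR (- ln (s ^+ 2)) else 0.
  apply/funext => s; rewrite /hat_weight; case: ifP => // /andP[s0 _].
  by rewrite expRN lnK// posrE exprn_gt0.
apply: measurable_fun_ifT => //.
- by apply: measurable_and; [exact: measurable_fun_ltr|exact: measurable_fun_ler].
- apply: (measurableT_comp (@measurable_expR R)); apply: measurable_funN.
  by apply: (measurableT_comp (@measurable_ln R)); exact: measurable_funX.
Qed.

Lemma measurable_hat T r : measurable_fun setT (fun s : RR => (hat_weight T s * Num.max 0 (s - r))%:E).
Proof.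
apply/measurable_EFinP; apply: measurable_funM; first exact: measurable_hat_weight.
by apply: measurable_maxr => //; exact: measurable_funB.
Qed.

Lemma hat_ge0 T r s : 0 <= hat_weight T s * Num.max 0 (s - r).
Proof. by rewrite mulr_ge0 ?hat_weight_ge0// le_max lexx. Qed.

Lemma hat_mix_mid T r : 0 < r -> r < T -> hat_mix T r = (ln T - ln r - 1 + r / T)%:E.
Proof.
move=> r0 rT; have T0 := lt_trans r0 rT.
have -> : hat_mix T r = (\int[leb]_(s in `[r, T]) (s^-1 - r * (s ^- 2))%:E)%E.
  rewrite [RHS]integral_mkcond; apply: eq_integral => s _; rewrite patchE /hat_weight.
  case: (boolP (s \in `[r, T]%classic)) => [|/negP h].
    rewrite inE/= in_itv/= => /andP[rs sT]; have s0 := lt_le_trans r0 rs.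
    rewrite s0 sT/= max_r ?subr_ge0//; congr EFin; field; exact: lt0r_neq0.
  case: ifPn => [/andP[s0 sT]|_]; last by rewrite mul0r.
  rewrite max_l ?mulr0// subr_le0 leNgt; apply/negP => rs.
  by apply: h; rewrite inE/= in_itv/= (ltW rs) sT.
have dF s : r <= s <= T -> is_derive s 1 (fun s => ln s + r * s^-1) (s^-1 - r * (s ^- 2)).
  move=> /andP[rs _]; have s0 := lt_le_trans r0 rs; have sn := lt0r_neq0 s0.
  have h := is_derive1D (@is_derive1_ln_comp R id s 1 s0 (is_derive1_id s))
    (is_derive1Z r (is_deriveV (f := id) sn (is_derive1_id s))).
  by apply: (is_derive_eq h); rewrite div1r /GRing.scale/= mulr1 mulrN.
rewrite (integral_derive rT _ dF).
  by congr EFin; field; rewrite !lt0r_neq0.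
move=> s /andP[rs _]; have s0 := lt_le_trans r0 rs; have sn := lt0r_neq0 s0.
apply: cvgB; first exact: cvgV.
apply: cvgM; first exact: cvg_cst.
apply: cvgV; first by rewrite expf_neq0.
exact: (@exprn_continuous _ 2 s).
Qed.

Lemma hat_mix_large T r : T <= r -> hat_mix T r = 0%E.
Proof.
move=> Tr; apply: integral0_eq => s _; congr EFin; rewrite /hat_weight.
case: ifPn => [/andP[s0 sT]|_]; last by rewrite mul0r.
by rewrite max_l ?mulr0// subr_le0 (le_trans sT).
Qed.

Lemma hat_mix0 T : 0 < T -> hat_mix T 0 = +oo%E.
Proof.
move=> T0; apply/eqyP => A A0.
(* Chosen so that [ln T - ln e - 1 = A]. *)
pose e := T * expR (- (A + 1)).
have e0 : 0 < e by rewrite mulr_gt0 ?expR_gt0.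
have eT : e < T by rewrite gtr_pMr// expR_lt1; lra.
apply: (@le_trans _ _ (hat_mix T e)).
  rewrite hat_mix_mid// lee_fin /e lnM ?posrE ?expR_gt0// expRK.
  have := divr_ge0 (ltW e0) (ltW T0); rewrite /e; lra.
apply: ge0_le_integral => //.
- by move=> s _; rewrite lee_fin hat_ge0.
- exact: measurable_hat.
- exact: measurable_hat.
- move=> s _; rewrite lee_fin ler_wpM2l ?hat_weight_ge0//.
  by rewrite ge_max le_max lexx/= le_max lerD2l; lra.
Qed.

(** Below [T] the error is exactly [r / T]. From [T] on the mixture vanishes, and
    [ln (r / T) <= r / T - 1] gives the same bound. At [r = 0] both the mixture and [- lne 0] are
    [+oo]. *)
Lemma hat_mix_bounds T r : 0 < T -> 0 <= r ->
  ((ln T - 1)%:E - lne r%:E <= hat_mix T r)%E /\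
  (hat_mix T r <= (ln T - 1)%:E - lne r%:E + (r / T)%:E)%E.
Proof.
move=> T0; rewrite le_eqVlt => /predU1P[<-|r0].
  by rewrite hat_mix0// le0_lneNy//= !leey.
rewrite lne_EFin//; have [Tr|rT] := leP T r; last first.
  rewrite hat_mix_mid// -EFinB -EFinD !lee_fin; split; last lra.
  have := divr_ge0 (ltW r0) (ltW T0); lra.
rewrite hat_mix_large// -EFinB -EFinD !lee_fin; split.
  have : ln T <= ln r by rewrite ler_ln ?posrE; lra.
  lra.
have := @le_ln1Dx R (r / T - 1); rewrite subrKC ln_div ?posrE// ltrBrDr addNr divr_gt0// => /(_ isT).
lra.
Qed.

(** [z.1] is the pair of the length and the left end of an interval. The interval is half-open on
    the left, so that its mass is an increment of the distribution function. *)
Definition interval_ind (z : (RR * RR) * RR) : \bar R :=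
  ((z.1.2 < z.2) && (z.2 <= z.1.2 + z.1.1))%:R%:E.

Lemma interval_ind_ge0 z : (0 <= interval_ind z)%E.
Proof. by rewrite lee_fin ler0n. Qed.

Lemma measurable_interval_ind : measurable_fun setT interval_ind.
Proof.
apply/measurable_EFinP.
have -> : (fun z : (RR * RR) * RR => ((z.1.2 < z.2) && (z.2 <= z.1.2 + z.1.1))%:R : R) =
    (fun z => if (z.1.2 < z.2) && (z.2 <= z.1.2 + z.1.1) then 1 else 0).
  by apply/funext => z; case: ifP.
apply: measurable_fun_ifT => //.
have m1 : measurable_fun setT (fun z : (RR * RR) * RR => z.1.1).
  exact: (measurableT_comp measurable_fst measurable_fst).
have m2 : measurable_fun setT (fun z : (RR * RR) * RR => z.1.2).
  exact: (measurableT_comp measurable_snd measurable_fst).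
have m3 : measurable_fun setT (fun z : (RR * RR) * RR => z.2) by exact: measurable_snd.
apply: measurable_and; first exact: measurable_fun_ltr.
by apply: measurable_fun_ler => //; exact: measurable_funD.
Qed.

Lemma measurable_hat_weight_fst T :
  measurable_fun setT (fun o : RR * RR => (hat_weight T o.1)%:E).
Proof.
apply/measurable_EFinP.
exact: (measurableT_comp (measurable_hat_weight T) measurable_fst).
Qed.

Lemma integral_interval_ind s x y :
  (\int[leb]_u (interval_ind ((s, u), x) * interval_ind ((s, u), y)) =
   (Num.max 0 (s - `|x - y|))%:E)%E.
Proof.
transitivity (\int[leb]_(u in `[(Num.max x y - s)%R, Num.min x y[) (cst 1%E) u)%E.
  rewrite [RHS]integral_mkcond; apply: eq_integral => u _; rewrite patchE /interval_ind/=.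
  rewrite -EFinM -natrM mulnb.
  have -> : (u \in `[Num.max x y - s, Num.min x y[%classic) =
      ((u < x) && (x <= u + s)) && ((u < y) && (y <= u + s)).
    rewrite mem_setE in_itv/= lerBlDr ge_max lt_min.
    by case: (u < x); case: (u < y); case: (x <= _); case: (y <= _).
  by case: ifP.
rewrite integral_cst//= mul1e lebesgue_measure_itv/= lte_fin.
have -> : s - `|x - y| = Num.min x y - (Num.max x y - s).
  by case: (leP x y) => xy; [rewrite ler0_norm|rewrite gtr0_norm]; lra.
case: ifPn => h.
  have h' : 0 <= Num.min x y - (Num.max x y - s) by rewrite subr_ge0 ltW.
  by rewrite (max_r h').
have h' : Num.min x y - (Num.max x y - s) <= 0 by rewrite subr_le0 leNgt.
by rewrite (max_l h').
Qed.

(* An alias of [leb \x leb], whose sigma-finiteness is not found by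
   unification: for a product of measures the library's canonical instance
   expects subprobabilities. *)
Definition plane_measure : set (RR * RR) -> \bar R := (leb \x leb)%E.

HB.instance Definition _ := Measure.on plane_measure.

Lemma plane_measure_sigma_finite : sigma_finite setT plane_measure.
Proof.
have /sigma_finiteP[F [TF ndF Foo]] := sigma_finiteT leb.
exists (fun n => F n `*` F n).
  rewrite -setXTT TF predeqE => -[x y]; split; last by move=> [n _ []/= ? ?]; split; exists n.
  move=> [/= [n _ Fnx] [k _ Fky]]; exists (maxn n k) => //; split.
  - by move: x Fnx; exact/subsetPset/ndF/leq_maxl.
  - by move: y Fky; exact/subsetPset/ndF/leq_maxr.
move=> k; have [mF Fk] := Foo k; split; first exact: measurableX.
by rewrite /plane_measure product_measure1E// lte_mul_pinfty// ge0_fin_numE.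
Qed.

HB.instance Definition _ := Measure_isSigmaFinite.Build _ _ _ plane_measure
  plane_measure_sigma_finite.

Lemma hat_mixE T x y :
  (\int[plane_measure]_o (interval_ind (o, x) * interval_ind (o, y) * (hat_weight T o.1)%:E) =
   hat_mix T `|x - y|%R)%E.
Proof.
have mi x' : measurable_fun setT (fun o => interval_ind (o, x')).
  exact: (measurableT_comp measurable_interval_ind (pair2_measurable x')).
apply: (etrans (fubini_tonelli1 (m1 := leb) (m2 := leb) _ _ _)).
- by apply: emeasurable_funM; [exact: emeasurable_funM|exact: measurable_hat_weight_fst].
- by move=> o; rewrite !mule_ge0 ?interval_ind_ge0// lee_fin hat_weight_ge0.
apply: eq_integral => s _; rewrite /fubini_F/=.
have mi2 x' : measurable_fun setT (fun u => interval_ind ((s, u), x')).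
  exact: (measurableT_comp (mi x') (pair1_measurable s)).
rewrite ge0_integralZr//; last 3 first.
- exact: emeasurable_funM.
- by move=> u _; rewrite mule_ge0 ?interval_ind_ge0.
- by rewrite lee_fin hat_weight_ge0.
by rewrite integral_interval_ind -EFinM mulrC.
Qed.

End LogKernel.

(** * Comparison of logarithmic energies with energies of hat mixtures *)

Section LogEnergy.
Variable R : realType.
Local Notation leb := (@lebesgue_measure R).
Local Notation RR := (measurableTypeR R).
Local Notation plane := (@plane_measure R).
Implicit Types (mu nu : probability RR R) (T : R).
Local Open Scope ereal_scope.

Lemma measurable_lne_EFin : measurable_fun setT (fun r : RR => lne r%:E).
Proof.
have -> : (fun r : RR => lne r%:E) = (fun r => if (r <= 0)%R then -oo else (ln r)%:E).
  by apply/funext => r; case: ifPn => [r0|]; [rewrite le0_lneNy// lee_fin|rewrite -ltNge => r0; rewrite lne_EFin].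
apply: measurable_fun_ifT => //; first exact: measurable_fun_ler.
by apply/measurable_EFinP; exact: measurable_ln.
Qed.

Lemma measurable_dist : measurable_fun setT (fun z : RR * RR => `|z.1 - z.2|%R : RR).
Proof.
apply: (measurableT_comp (@normr_measurable R setT)).
by apply: measurable_funB; [exact: measurable_fst|exact: measurable_snd].
Qed.

(* A nonnegative substitute for [- lne `|x - y|]. *)
Definition log_gap (z : RR * RR) : \bar R :=
  (`|z.1| + `|z.2|)%:E - lne (`|z.1 - z.2|%R)%:E.

Lemma log_gap_ge0 z : 0 <= log_gap z.
Proof.
rewrite /log_gap; have [z0|z0] := eqVneq (`|z.1 - z.2|%R) 0%R.
  by rewrite z0 le0_lneNy//= leey.
have r0 : (0 < `|z.1 - z.2|)%R by rewrite lt_neqAle eq_sym z0 normr_ge0.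
rewrite lne_EFin// -EFinB lee_fin subr_ge0.
by apply: le_trans (ltW (ln_sublinear r0)) _; exact: ler_normB.
Qed.

Lemma measurable_sum_norm : measurable_fun setT (fun z : RR * RR => (`|z.1| + `|z.2|)%R : RR).
Proof.
by apply: measurable_funD; apply: (measurableT_comp (@normr_measurable R setT));
  [exact: measurable_fst|exact: measurable_snd].
Qed.

Lemma measurable_log_gap : measurable_fun setT log_gap.
Proof.
apply: emeasurable_funB; first by apply/measurable_EFinP; exact: measurable_sum_norm.
exact: (measurableT_comp measurable_lne_EFin measurable_dist).
Qed.

Definition gap_energy mu nu : \bar R := \int[mu \x nu]_z log_gap z.

Definition abs_mean mu : \bar R := \int[mu]_x (`|x|%R)%:E.

Definition hat_energy T mu nu : \bar R := \int[mu \x nu]_z hat_mix T (`|z.1 - z.2|%R).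

Lemma hat_mix_ge0 T r : 0 <= hat_mix T r.
Proof. by apply: integral_ge0 => s _; rewrite lee_fin hat_ge0. Qed.

Lemma measurable_hat_mix_dist T : measurable_fun setT (fun z : RR * RR => hat_mix T (`|z.1 - z.2|%R)).
Proof.
have h : measurable_fun setT (hat_mix T : RR -> \bar R).
  pose f (z : RR * RR) : \bar R := (hat_weight T z.2 * Num.max 0 (z.2 - z.1))%:E.
  apply: (measurable_fun_fubini_tonelli_F (m2 := leb) f).
  - apply/measurable_EFinP; apply: measurable_funM.
      exact: (measurableT_comp (measurable_hat_weight T) measurable_snd).
    by apply: measurable_maxr => //; apply: measurable_funB; [exact: measurable_snd|exact: measurable_fst].
  - by move=> z; rewrite lee_fin hat_ge0.
exact: (measurableT_comp h measurable_dist).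
Qed.

Lemma integral_sum_norm mu nu :
  \int[mu \x nu]_z (`|z.1| + `|z.2|)%:E = abs_mean mu + abs_mean nu.
Proof.
have mn : measurable_fun setT (fun x : RR => (`|x|%R)%:E).
  by apply/measurable_EFinP; exact: normr_measurable.
rewrite fubini_tonelli1//=; last first.
  by apply/measurable_EFinP; exact: measurable_sum_norm.
have inner x : fubini_F nu (fun z : RR * RR => (`|z.1| + `|z.2|)%:E) x = (`|x|%R)%:E + abs_mean nu.
  rewrite /fubini_F/=; under eq_integral do rewrite EFinD.
  rewrite ge0_integralD//=; congr (_ + _).
  by rewrite integral_cst//= probability_setT mule1.
under eq_integral do rewrite inner.
rewrite ge0_integralD//=; last by move=> x _; exact: integral_ge0.
by congr (_ + _); rewrite integral_cst//= probability_setT mule1.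
Qed.

(** [expR 1 <= T] makes [ln T - 1] nonnegative: both sides are then sums of integrals of nonnegative
    functions, additive even when infinite. *)
Lemma gap_hat_lower T mu nu : (expR 1 <= T)%R ->
  (ln T - 1)%:E + gap_energy mu nu <= hat_energy T mu nu + (abs_mean mu + abs_mean nu).
Proof.
move=> eT; have T0 : (0 < T)%R by exact: lt_le_trans (expR_gt0 1) eT.
have c0 : (0 <= ln T - 1)%R by rewrite subr_ge0 -(expRK 1%R) ler_ln ?posrE ?expR_gt0.
rewrite -integral_sum_norm.
have -> : (ln T - 1)%:E = \int[mu \x nu]_z (cst (ln T - 1)%:E) z.
  by rewrite integral_cst//= [X in _ * X](_ : _ = 1) ?mule1//; exact: probability_setT.
rewrite -ge0_integralD//=; last 2 first.
- by move=> z _; exact: log_gap_ge0.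
- exact: measurable_log_gap.
rewrite -ge0_integralD//=; last 3 first.
- by move=> z _; exact: hat_mix_ge0.
- exact: measurable_hat_mix_dist.
- by apply/measurable_EFinP; exact: measurable_sum_norm.
apply: ge0_le_integral => //=.
- by move=> z _; rewrite adde_ge0 ?log_gap_ge0.
- by apply: emeasurable_funD => //; exact: measurable_log_gap.
- apply: emeasurable_funD; first exact: measurable_hat_mix_dist.
  by apply/measurable_EFinP; exact: measurable_sum_norm.
- move=> z _; have [h _] := hat_mix_bounds T0 (normr_ge0 (z.1 - z.2)%R).
  have -> : log_gap z = - lne (`|z.1 - z.2|%R)%:E + (`|z.1| + `|z.2|)%:E by exact: addeC.
  by rewrite addeA leeD2r.
Qed.

Lemma gap_hat_upper T mu nu : (expR 1 <= T)%R ->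
  hat_energy T mu nu + (abs_mean mu + abs_mean nu) <=
  (ln T - 1)%:E + gap_energy mu nu + T^-1%:E * (abs_mean mu + abs_mean nu).
Proof.
move=> eT; have T0 : (0 < T)%R by exact: lt_le_trans (expR_gt0 1) eT.
have c0 : (0 <= ln T - 1)%R by rewrite subr_ge0 -(expRK 1%R) ler_ln ?posrE ?expR_gt0.
have ms : measurable_fun setT (fun z : RR * RR => (`|z.1| + `|z.2|)%:E).
  by apply/measurable_EFinP; exact: measurable_sum_norm.
rewrite -integral_sum_norm.
have -> : (ln T - 1)%:E = \int[mu \x nu]_z (cst (ln T - 1)%:E) z.
  by rewrite integral_cst//= [X in _ * X](_ : _ = 1) ?mule1//; exact: probability_setT.
rewrite -ge0_integralZl//=; last by rewrite lee_fin invr_ge0 ltW.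
rewrite -ge0_integralD//=; last 2 first.
- by move=> z _; exact: hat_mix_ge0.
- exact: measurable_hat_mix_dist.
rewrite -ge0_integralD//=; last 2 first.
- by move=> z _; exact: log_gap_ge0.
- exact: measurable_log_gap.
rewrite -ge0_integralD//=; last 4 first.
- by move=> z _; rewrite adde_ge0 ?log_gap_ge0.
- by apply: emeasurable_funD => //; exact: measurable_log_gap.
- by move=> z _; rewrite mule_ge0// lee_fin ?invr_ge0 ?ltW.
- exact: measurable_funeM.
apply: ge0_le_integral => //=.
- by move=> z _; rewrite adde_ge0 ?hat_mix_ge0.
- by apply: emeasurable_funD => //; exact: measurable_hat_mix_dist.
- apply: emeasurable_funD; last exact: measurable_funeM.
  by apply: emeasurable_funD => //; exact: measurable_log_gap.
- move=> z _; have [_ h] := hat_mix_bounds T0 (normr_ge0 (z.1 - z.2)%R).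
  rewrite /log_gap -EFinM.
  apply: (@le_trans _ _ ((ln T - 1)%:E - lne (`|z.1 - z.2|%R)%:E + (`|z.1 - z.2| / T)%:E + (`|z.1| + `|z.2|)%:E)).
    by rewrite leeD2r.
  rewrite addeAC; set L := - lne _.
  rewrite [X in _ <= _ + X + _]addeC [X in _ <= X + _]addeA; apply: leeD => //.
  by rewrite lee_fin mulrC ler_wpM2l ?invr_ge0 ?(ltW T0)//; exact: ler_normB.
Qed.

Definition interval_mass mu (o : RR * RR) : R := fine (mu `]o.2, (o.2 + o.1)%R]%classic).

Lemma smear_interval mu o : smear (@interval_ind R) mu o = (interval_mass mu o)%:E.
Proof.
rewrite /interval_mass fineK ?fin_num_measure// /smear /interval_ind/=.
transitivity (\int[mu]_x (\1_(`]o.2, (o.2 + o.1)%R]%classic) x)%:E); last first.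
  by rewrite integral_indic// setIT.
by apply: eq_integral => x _; rewrite indicE mem_setE in_itv.
Qed.

Lemma measurable_interval_mass mu : measurable_fun setT (interval_mass mu : RR * RR -> RR).
Proof.
apply/measurable_EFinP.
have -> : EFin \o interval_mass mu = smear (@interval_ind R) mu.
  by apply/funext => o; rewrite /= smear_interval.
exact: (measurable_smear (@measurable_interval_ind R) (@interval_ind_ge0 R)).
Qed.

Lemma interval_mass_ge0 mu o : (0 <= interval_mass mu o)%R.
Proof. exact: fine_ge0. Qed.

Lemma hat_energyE T mu nu : hat_energy T mu nu =
  \int[plane]_o (interval_mass mu o * interval_mass nu o * hat_weight T o.1)%:E.
Proof.
rewrite /hat_energy fubini_tonelli1/=; last 2 first.
- exact: measurable_hat_mix_dist.
- by move=> z; exact: hat_mix_ge0.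
transitivity (\int[mu]_x \int[nu]_y \int[plane]_o
    (interval_ind (o, x) * interval_ind (o, y) * (hat_weight T o.1)%:E)).
  by apply: eq_integral => x _; apply: eq_integral => y _; rewrite hat_mixE.
rewrite (@smear_energy _ _ (RR * RR)%type RR R plane _ _ (@measurable_interval_ind R) (@interval_ind_ge0 R)
  (@measurable_hat_weight_fst R T)); last by move=> o; rewrite lee_fin hat_weight_ge0.
by apply: eq_integral => o _; rewrite !smear_interval -!EFinM.
Qed.

Definition hat_distance T mu nu : \bar R :=
  \int[plane]_o ((interval_mass mu o - interval_mass nu o) ^+ 2 * hat_weight T o.1)%:E.

Lemma measurable_hat_weight_fst_R T : measurable_fun setT (fun o : RR * RR => hat_weight T o.1 : RR).
Proof. exact: (measurableT_comp (measurable_hat_weight T) measurable_fst). Qed.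

Lemma measurable_hat_distance T mu nu : measurable_fun setT
  (fun o => ((interval_mass mu o - interval_mass nu o) ^+ 2 * hat_weight T o.1)%:E).
Proof.
apply/measurable_EFinP; apply: measurable_funM; last exact: measurable_hat_weight_fst_R.
by apply: measurable_funX; apply: measurable_funB; exact: measurable_interval_mass.
Qed.

(** The identity [2ab + (a - b)^2 = a^2 + b^2] under the integral, arranged without subtraction of
    energies so that infinite values are allowed. *)
Lemma hat_energy_polarization T mu nu :
  2%:E * hat_energy T mu nu + hat_distance T mu nu = hat_energy T mu mu + hat_energy T nu nu.
Proof.
have mQ mu1 mu2 : measurable_fun setT
    (fun o => (interval_mass mu1 o * interval_mass mu2 o * hat_weight T o.1)%:E).
  apply/measurable_EFinP; apply: measurable_funM; last exact: measurable_hat_weight_fst_R.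
  by apply: measurable_funM; exact: measurable_interval_mass.
have Q0 mu1 mu2 o : 0 <= (interval_mass mu1 o * interval_mass mu2 o * hat_weight T o.1)%:E.
  by rewrite lee_fin !mulr_ge0 ?interval_mass_ge0 ?hat_weight_ge0.
rewrite !hat_energyE -ge0_integralZl//= -ge0_integralD//=; last 4 first.
- by move=> o _; rewrite mule_ge0.
- exact: measurable_funeM.
- by move=> o _; rewrite lee_fin mulr_ge0 ?sqr_ge0 ?hat_weight_ge0.
- exact: measurable_hat_distance.
rewrite -ge0_integralD//=; apply: eq_integral => o _.
by rewrite -EFinM -!EFinD; congr EFin; ring.
Qed.

(** Allows the distance to be kept at a fixed [T] while the error of the hat approximation is sent
    to 0 by a growing [T']. *)
Lemma hat_distance_mono T T' mu nu : (T <= T')%R -> hat_distance T mu nu <= hat_distance T' mu nu.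
Proof.
move=> TT; apply: ge0_le_integral => //=.
- by move=> o _; rewrite lee_fin mulr_ge0 ?sqr_ge0 ?hat_weight_ge0.
- exact: measurable_hat_distance.
- exact: measurable_hat_distance.
- move=> o _; rewrite lee_fin ler_wpM2l ?sqr_ge0// /hat_weight.
  case: ifPn => [/andP[s0 sT]|_]; first by rewrite s0 (le_trans sT).
  by case: ifPn => // _; rewrite invr_ge0 sqr_ge0.
Qed.

(** In the polarization identity the two self-energies are bounded from above and the cross energy
    from below. The constants [ln T - 1] cancel, because both measures have mass 1, and the
    remaining error [2 * (M + N) / T] is arbitrarily small. *)
Lemma gap_energy_ineq mu nu (M N : R) :
  abs_mean mu = M%:E -> abs_mean nu = N%:E ->
  gap_energy mu mu <= (2 * M)%:E -> gap_energy nu nu <= (2 * N)%:E ->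
  2%:E * gap_energy mu nu + hat_distance (expR 1) mu nu <= (2 * (M + N))%:E.
Proof.
move=> mM mN EM EN; apply/lee_addgt0Pr => e e0.
have M0 : (0 <= M)%R by rewrite -lee_fin -mM; exact: integral_ge0.
have N0 : (0 <= N)%R by rewrite -lee_fin -mN; exact: integral_ge0.
pose T := Num.max (expR 1) ((2 * (M + N) + 1) / e)%R.
have eT : (expR 1 <= T)%R by rewrite le_max lexx.
have T0 : (0 < T)%R by exact: lt_le_trans (expR_gt0 1) eT.
have Te : (2 * (M + N) / T <= e)%R.
  have hT : ((2 * (M + N) + 1) / e <= T)%R by rewrite le_max lexx orbT.
  by rewrite ler_pdivrMr// mulrC; rewrite ler_pdivrMr// in hT; lra.
have hM := gap_hat_upper mu mu eT; have hN := gap_hat_upper nu nu eT.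
have hMN := gap_hat_lower mu nu eT; have pol := hat_energy_polarization T mu nu.
have mono := hat_distance_mono mu nu eT.
have Q0 mu1 mu2 : 0 <= hat_energy T mu1 mu2 by apply: integral_ge0 => z _; exact: hat_mix_ge0.
have E0 : 0 <= gap_energy mu nu by apply: integral_ge0 => z _; exact: log_gap_ge0.
have D0 T' : 0 <= hat_distance T' mu nu.
  by apply: integral_ge0 => o _; rewrite lee_fin mulr_ge0 ?sqr_ge0 ?hat_weight_ge0.
(* Finiteness passes from the given bounds to the hat energies of [mu] and [nu], then by
   polarization to the distance and the cross energies. *)
have fin (x : \bar R) (y : R) : 0 <= x -> x <= y%:E -> exists2 r : R, x = r%:E & (0 <= r)%R.
  by case: x => [r|//|//]; rewrite ?lee_fin => r0 _; exists r.
have EM0 : 0 <= gap_energy mu mu by apply: integral_ge0 => z _; exact: log_gap_ge0.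
have EN0 : 0 <= gap_energy nu nu by apply: integral_ge0 => z _; exact: log_gap_ge0.
have [em eme _] := fin _ _ EM0 EM; have [en ene _] := fin _ _ EN0 EN.
rewrite eme lee_fin in EM; rewrite ene lee_fin in EN.
rewrite mM eme -!EFinD in hM.
rewrite mN ene -!EFinD in hN.
have [qm qme qm0] : exists2 r : R, hat_energy T mu mu = r%:E & (0 <= r)%R.
  by move: hM (Q0 mu mu); case: (hat_energy T mu mu) => [r|//|//] _; rewrite lee_fin => r0; exists r.
have [qn qne qn0] : exists2 r : R, hat_energy T nu nu = r%:E & (0 <= r)%R.
  by move: hN (Q0 nu nu); case: (hat_energy T nu nu) => [r|//|//] _; rewrite lee_fin => r0; exists r.
rewrite qme -EFinD lee_fin in hM; rewrite qne -EFinD lee_fin in hN.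
rewrite qme qne -EFinD in pol.
have [dT dTe dT0] : exists2 r : R, hat_distance T mu nu = r%:E & (0 <= r)%R.
  apply: (fin _ (qm + qn)%R (D0 T)); rewrite -pol leeDr// mule_ge0//.
rewrite dTe in pol mono.
have [q qe q0] : exists2 r : R, hat_energy T mu nu = r%:E & (0 <= r)%R.
  move: pol (Q0 mu nu); case: (hat_energy T mu nu) => [r _ r0|pol _|//].
    by exists r => //; rewrite -lee_fin.
  by move: pol; rewrite gt0_muley ?lte_fin.
rewrite qe -EFinM -EFinD in pol; case: pol => pol.
rewrite qe mM mN -!EFinD in hMN.
have [emn emne emn0] : exists2 r : R, gap_energy mu nu = r%:E & (0 <= r)%R.
  by move: hMN E0; case: (gap_energy mu nu) => [r|//|//] _; rewrite lee_fin => r0; exists r.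
rewrite emne -EFinD lee_fin in hMN; rewrite emne.
have [d de d0] : exists2 r : R, hat_distance (expR 1) mu nu = r%:E & (0 <= r)%R by exact: (fin _ _ (D0 _) mono).
rewrite de lee_fin in mono; rewrite de -EFinM -!EFinD lee_fin.
have eqT : (T^-1 * (M + M) + T^-1 * (N + N) = 2 * (M + N) / T)%R by ring.
lra.
Qed.

End LogEnergy.

(** * Vanishing distance implies equality of the measures *)

Section HatDistanceSeparates.
Variable R : realType.
Local Notation leb := (@lebesgue_measure R).
Local Notation RR := (measurableTypeR R).
Implicit Types (mu nu : probability RR R) (T : R).

(** The identity as a random variable: its [cdf] is the distribution function of the measure, known
    to be right continuous. *)
Let idRR : RR -> R := idfun.

#[local] HB.instance Definition _ :=
  @isMeasurableFun.Build _ _ _ _ idRR (@measurable_id _ _ setT).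

Definition ray_mass mu (r : R) : R := fine (mu `]-oo, r]%classic).

Lemma ray_mass_right_continuous mu : right_continuous (ray_mass mu).
Proof.
move=> a; have -> : ray_mass mu = fine \o cdf (idRR : {RV mu >-> R}).
  by apply/funext => r; rewrite /= /cdf /distribution /pushforward preimage_id.
apply: fine_cvg; rewrite fineK ?fin_num_measure//.
exact: cdf_right_continuous.
Qed.

Lemma interval_mass_ray mu (o : RR * RR) : 0 <= o.1 ->
  interval_mass mu o = ray_mass mu (o.2 + o.1) - ray_mass mu o.2.
Proof.
move=> o0; rewrite /interval_mass /ray_mass.
have sub : `]-oo, o.2]%classic `<=` (`]-oo, o.2 + o.1]%classic : set RR).
  by apply: subset_itvl; rewrite bnd_simp lerDl.
have -> : `]o.2, o.2 + o.1]%classic = `]-oo, o.2 + o.1]%classic `\` `]-oo, o.2]%classic :> set RR.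
  by rewrite -[RHS]setCK setCD setCitvl setUC -[LHS]setCK setCitv.
rewrite measureD// ?setIidr//; last by rewrite -ge0_fin_numE// fin_num_measure.
by rewrite fineB// fin_num_measure.
Qed.

Lemma right_near (f : R -> R) (a e : R) : f x @[x --> a^'+] --> f a -> 0 < e ->
  exists2 d : R, 0 < d & forall x, a < x < a + d -> `|f a - f x| < e.
Proof.
move=> /cvgrPdist_lt/(_ e) h e0; have [d /= d0 hd] := h e0.
exists d => // x /andP[ax xd]; apply: hd => //=.
by rewrite distrC gtr0_norm ?subr_gt0// ltrBlDl.
Qed.

(** Distance 0 means that the masses of almost all intervals of length at most [T] agree. One
    exception would, by right continuity, spread to a box of lengths and left ends of positive area.
    So the difference [H] of the distribution functions is constant, and the measures agree on
    half-open intervals, which generate. *)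
Lemma hat_distance_eq0 T mu nu : 0 < T -> hat_distance T mu nu = 0%E ->
  forall S, measurable S -> mu S = nu S.
Proof.
move=> T0 D0; pose H r := ray_mass mu r - ray_mass nu r.
have rcH a : H x @[x --> a^'+] --> H a.
  by apply: cvgB; exact: ray_mass_right_continuous.
have HE (o : RR * RR) : 0 <= o.1 ->
    interval_mass mu o - interval_mass nu o = H (o.2 + o.1) - H o.2.
  by move=> o0; rewrite !interval_mass_ray// /H; ring.
have small u s : 0 < s < T -> H (u + s) = H u.
  move=> /andP[s0 sT]; apply/eqP; rewrite -subr_eq0; apply/negP => /negP dn.
  pose d := `|H (u + s) - H u|; have d0 : 0 < d / 2 by rewrite divr_gt0// normr_gt0.
  have [e1 e10 he1] := right_near (rcH u) d0.
  have [e2 e20 he2] := right_near (rcH (u + s)) d0.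
  (* [e2] is halved because on the box the right end exceeds [u + s] by up to [2 * e]; the bound
     [T - s] keeps the lengths below [T], where the weight is positive. *)
  pose e := Num.min (Num.min e1 (e2 / 2)) (T - s).
  have e0 : 0 < e by rewrite !lt_min e10 divr_gt0// subr_gt0.
  have [ee1 ee2 eT] : [/\ e <= e1, e <= e2 / 2 & e <= T - s].
    by split; rewrite /e !ge_min lexx ?orbT.
  have mf := measurable_hat_distance T mu nu.
  have [N [mN N0 Nf]] : ae_eq (@plane_measure R) setT
      (fun o => ((interval_mass mu o - interval_mass nu o) ^+ 2 * hat_weight T o.1)%:E) (cst 0%E).
    apply/ae_eq_integral_abs => //; rewrite -[RHS]D0; apply: eq_integral => o _.
    by rewrite gee0_abs// lee_fin mulr_ge0 ?sqr_ge0 ?hat_weight_ge0.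
  pose B : set (RR * RR) := `]s, s + e[%classic `*` `]u, u + e[%classic.
  have boxN : B `<=` N.
    move=> [v w] /= [] /=; rewrite !in_itv/= => /andP[sv ve] /andP[uw we].
    apply: Nf => /= h; have {h} := h Logic.I => -[] /eqP.
    have v0 : 0 < v by exact: lt_trans sv.
    rewrite /hat_weight v0 (_ : v <= T)/=; last by move: ve eT; lra.
    rewrite mulf_eq0 invr_eq0 !expf_eq0/= (gt_eqF v0) orbF HE/= ?ltW// subr_eq0 => /eqP h.
    have h1 := he1 w; have h2 := he2 (w + v).
    have {h1} : `|H u - H w| < d / 2 by apply: h1; rewrite uw/=; lra.
    have {h2} : `|H (u + s) - H (w + v)| < d / 2 by apply: h2; apply/andP; split; lra.
    rewrite h => h1 h2.
    have : d <= `|H (u + s) - H w| + `|H u - H w|.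
      by rewrite (distrC (H u)); exact: ler_distD.
    by lra.
  have : (@plane_measure R B <= 0)%E.
    by rewrite -N0; apply: le_measure => //; rewrite inE//; exact: measurableX.
  rewrite /plane_measure product_measure1E//= !lebesgue_measure_itv/= !lte_fin !ltrDl e0.
  by rewrite -!EFinD -EFinM lee_fin !(addrC _ e) !addrK leNgt mulr_gt0.
have const u s : 0 <= s -> H (u + s) = H u.
  rewrite le_eqVlt => /predU1P[<-|s0]; first by rewrite addr0.
  (* Longer steps are divided into [n] equal steps shorter than [T]. *)
  pose n := (Num.truncn (s / T)).+1; have n0 : 0 < n%:R :> R by rewrite ltr0n.
  have sn : s / n%:R < T.
    by rewrite ltr_pdivrMr// mulrC -ltr_pdivrMr//; exact: truncnS_gt.
  have it (k : nat) : H (u + k%:R * (s / n%:R)) = H u.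
    elim: k => [|k IH]; first by rewrite mul0r addr0.
    by rewrite -addn1 natrD mulrDl mul1r addrA small// divr_gt0.
  by rewrite -[RHS](it n) mulrC divfK// gt_eqF.
apply: (@measure_unique _ R RR (@ocitv R) (fun n => `](- n%:R), n%:R]%classic)) => //.
- exact: ocitvI.
- by move=> i; exact: is_ocitv.
- rewrite -subTset => x _; exists (Num.truncn `|x|).+1 => //=; rewrite in_itv/=.
  have := truncnS_gt `|x|; rewrite ltr_norml => /andP[-> /ltW]; exact.
- move=> _ [[a b] _ <-]/=; have [ab|ba] := leP a b; last first.
    by rewrite set_itv_ge ?measure0// bnd_simp -leNgt ltW.
  have ab0 : 0 <= b - a by rewrite subr_ge0.
  have e1 (m : probability RR R) : m `]a, b]%classic = (interval_mass m (b - a, a))%:E.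
    by rewrite /interval_mass fineK ?fin_num_measure//= subrKC.
  rewrite !e1; congr EFin; apply/eqP; rewrite -subr_eq0 HE//=; apply/eqP.
  by rewrite const// subrr.
- by move=> k; rewrite -ge0_fin_numE// fin_num_measure.
Qed.

End HatDistanceSeparates.

(** * The extremal measure and its potential *)

Section IntegralComplements.
Local Open Scope ereal_scope.
Context d (T : measurableType d) (R : realType).

Lemma integral_full_set (P : {measure set T -> \bar R}) (D : set T) (h : T -> \bar R) :
  measurable D -> P (~` D) = 0 -> measurable_fun setT h ->
  \int[P]_x h x = \int[P]_(x in D) h x.
Proof.
move=> mD D0 mh; rewrite [RHS]integral_mkcond; apply: ae_eq_integral => //.
  by apply/measurable_restrict => //; rewrite setTI; exact: measurable_funTS.
exists (~` D); split => //; first exact: measurableC.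
move=> x /= /not_implyP[_ h1] Dx; apply: h1; rewrite patchE mem_set//.
Qed.

(** The smaller function may have integral [-oo]; passing to its positive part reduces the claim to
    nonnegative functions. *)
Lemma le_integral_ge0 (P : {measure set T -> \bar R}) (D : set T) (f g : T -> \bar R) :
  measurable D -> measurable_fun D f -> measurable_fun D g ->
  (forall x, D x -> 0 <= g x) -> (forall x, D x -> f x <= g x) ->
  \int[P]_(x in D) f x <= \int[P]_(x in D) g x.
Proof.
move=> mD mf mg g0 fg; rewrite integralE.
apply: (@le_trans _ _ (\int[P]_(x in D) f^\+ x)).
  by rewrite -[leRHS]adde0 leeD2l// oppe_le0 integral_ge0.
apply: ge0_le_integral => //; first exact: measurable_funepos.
by move=> x Dx; rewrite funeposE ge_max fg// g0.
Qed.

End IntegralComplements.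

Section DensityMeasure.
Local Open Scope ereal_scope.
Variable R : realType.
Local Notation leb := (@lebesgue_measure R).
Local Notation RR := (measurableTypeR R).

Record density := Density {
  density_fun :> RR -> R ;
  density_ge0 : forall x, (0 <= density_fun x)%R ;
  measurable_density : measurable_fun setT density_fun ;
  density_total : \int[leb]_x (density_fun x)%:E = 1 }.

Variable f : density.

Definition density_prob (S : set RR) : \bar R := \int[leb]_(x in S) (f x)%:E.

Let mf (S : set RR) : measurable_fun S (EFin \o f).
Proof. by apply/measurable_EFinP; apply: measurable_funTS; exact: measurable_density. Qed.

Let density_prob0 : density_prob set0 = 0.
Proof. by rewrite /density_prob integral_set0. Qed.

Let density_prob_ge0 S : 0 <= density_prob S.
Proof. by apply: integral_ge0 => x _; rewrite lee_fin density_ge0. Qed.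

Let density_prob_sigma_additive : semi_sigma_additive density_prob.
Proof.
move=> F mF tF mUF; rewrite /density_prob; apply: cvg_toP.
  apply: ereal_nondecreasing_is_cvgn => m n mn.
  by apply: lee_sum_nneg_natr => // k _ _; exact: density_prob_ge0.
by rewrite ge0_integral_bigcup// => x _; rewrite lee_fin density_ge0.
Qed.

HB.instance Definition _ := isMeasure.Build _ _ _ density_prob
  density_prob0 density_prob_ge0 density_prob_sigma_additive.

Let density_probT : density_prob setT = 1.
Proof. exact: density_total. Qed.

HB.instance Definition _ := Measure_isProbability.Build _ _ _ density_prob density_probT.

Lemma density_prob_dom : density_prob `<< leb.
Proof.
apply/null_content_dominatesP => S mS S0; exact: null_set_integral.
Qed.

(** The density agrees almost everywhere with the Radon-Nikodym derivative, both having the same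
    integral over every measurable set. *)
Lemma integral_density_prob (h : RR -> \bar R) : density_prob.-integrable setT h ->
  \int[density_prob]_x h x = \int[leb]_x (h x * (f x)%:E).
Proof.
move=> ih; rewrite -(Radon_Nikodym_change_of_variables density_prob_dom)//=.
have mh : measurable_fun setT h by exact: measurable_int ih.
apply: ae_eq_integral => //.
- apply: emeasurable_funM => //; apply: (measurable_int leb).
  by apply: Radon_Nikodym_integrable; exact: density_prob_dom.
- exact: emeasurable_funM.
- apply: ae_eqe_mul2l => /=.
  rewrite Radon_NikodymE//=; first exact: density_prob_dom.
  move=> fleb; case: cid => /= g [g1 g2 g3].
  apply: integral_ae_eq => //=.
  by move=> E ET mE; rewrite -g3.
Qed.

End DensityMeasure.

(** * The constraints as integrability and as bounds on nonnegative integrals *)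

Section Admissibility.
Local Open Scope ereal_scope.

(** The majorant [g] keeps the positive part finite, so a nonnegative integral forces the negative
    part to be finite too. This turns the logarithmic constraints into integrability. *)
Lemma integrable_integral_ge0 d (T : measurableType d) (R : realType)
    (m : {measure set T -> \bar R}) (f g : T -> \bar R) :
  measurable_fun setT f -> m.-integrable setT g -> (forall x, 0 <= g x) ->
  (forall x, f x <= g x) -> 0 <= \int[m]_x f x -> m.-integrable setT f.
Proof.
move=> mf ig g0 fg If.
have fp : \int[m]_x f^\+ x < +oo.
  apply: le_lt_trans (_ : \int[m]_x g x < +oo).
    apply: ge0_le_integral => //; first exact: measurable_funepos.
      exact: measurable_int ig.
    by move=> x _; rewrite funeposE ge_max fg g0.
  have /integrableP[_] := ig.
  by congr (_ < _); apply: eq_integral => x _; rewrite gee0_abs.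
have fp0 : 0 <= \int[m]_x f^\+ x by apply: integral_ge0 => x _; exact: funepos_ge0.
have fn0 : 0 <= \int[m]_x f^\- x by apply: integral_ge0 => x _; exact: funeneg_ge0.
apply/integrableP; split => //.
have -> : (fun x => `|f x|) = (fun x => f^\+ x + f^\- x) by exact: fune_abse.
rewrite ge0_integralD//; last 2 first.
- exact: measurable_funepos.
- exact: measurable_funeneg.
rewrite lte_add_pinfty//; move: If; rewrite integralE.
move: fp fp0 fn0; case: (\int[m]_x f^\+ x) => [a _ _|//|//].
by case: (\int[m]_x f^\- x) => // b; rewrite ltry.
Qed.

Variable R : realType.
Local Notation RR := (measurableTypeR R).
Implicit Types mu nu : probability RR R.

Lemma lne_le_norm (x : R) : lne (`|x|%R)%:E <= (`|x|%R)%:E.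
Proof.
have [->|x0] := eqVneq (`|x|%R) 0%R; first by rewrite le0_lneNy ?leNye.
have x1 : (0 < `|x|)%R by rewrite lt_neqAle eq_sym x0 normr_ge0.
by rewrite (lne_EFin x1) lee_fin ltW// ln_sublinear.
Qed.

Lemma measurable_lne_norm : measurable_fun setT (fun x : RR => lne (`|x|%R)%:E).
Proof. exact: (measurableT_comp (@measurable_lne_EFin R) (@normr_measurable R setT)). Qed.

Lemma integrable_norm mu M : abs_mean mu = M%:E ->
  mu.-integrable setT (fun x : RR => (`|x|%R)%:E).
Proof.
move=> mM; apply/integrableP; split; first by apply/measurable_EFinP; exact: normr_measurable.
by under eq_integral do rewrite gee0_abs//; rewrite -/(abs_mean mu) mM ltry.
Qed.

Lemma integrable_sum_norm mu nu M N : abs_mean mu = M%:E -> abs_mean nu = N%:E ->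
  (mu \x nu).-integrable setT (fun z : RR * RR => (`|z.1| + `|z.2|)%:E).
Proof.
move=> mM mN; apply/integrableP; split; first by apply/measurable_EFinP; exact: measurable_sum_norm.
under eq_integral do rewrite gee0_abs ?lee_fin ?addr_ge0//.
by rewrite integral_sum_norm mM mN -EFinD ltry.
Qed.

Let measurable_lne_dist : measurable_fun setT (fun z : RR * RR => lne (`|z.1 - z.2|%R)%:E).
Proof. exact: (measurableT_comp (@measurable_lne_EFin R) (@measurable_dist R)). Qed.

(** For finite mean [M], the integral of [log_gap] is [2 * M] minus the logarithmic energy;
    [log_energy_ge0] is the converse. *)
Lemma gap_energy_le mu M : abs_mean mu = M%:E -> 0 <= log_energy mu ->
  gap_energy mu mu <= (2 * M)%:E.
Proof.
move=> mM E0; have iN := integrable_sum_norm mM mM.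
have iL : (mu \x mu).-integrable setT (fun z : RR * RR => lne (`|z.1 - z.2|%R)%:E).
  apply: integrable_integral_ge0 iN _ _ E0 => //.
  by move=> z; apply: le_trans (lne_le_norm _) _; rewrite lee_fin ler_normB.
rewrite /gap_energy /log_gap integralB// integral_sum_norm mM -EFinD.
have -> : (2 * M = M + M)%R by ring.
by rewrite leeBlDr ?integrable_fin_num// leeDl.
Qed.

Lemma log_energy_ge0 mu M : abs_mean mu = M%:E -> gap_energy mu mu <= (2 * M)%:E ->
  0 <= log_energy mu.
Proof.
move=> mM E0; have iN := integrable_sum_norm mM mM.
have iG : (mu \x mu).-integrable setT (@log_gap R).
  apply/integrableP; split; first exact: measurable_log_gap.
  under eq_integral do rewrite gee0_abs ?log_gap_ge0//.
  by apply: le_lt_trans E0 _; rewrite ltry.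
rewrite /log_energy.
have -> : \int[mu \x mu]_z lne (`|z.1 - z.2|%R)%:E =
    \int[mu \x mu]_z ((`|z.1| + `|z.2|)%:E - log_gap z).
  by apply: eq_integral => z _; rewrite /log_gap oppeB// addeA subee// add0e.
rewrite integralB// integral_sum_norm mM -EFinD sube_ge0; last first.
  by rewrite integrable_fin_num.
by apply: le_trans E0 _; rewrite lee_fin; lra.
Qed.

Lemma integral_Rplus mu (h : RR -> \bar R) : supported_on_Rplus mu -> measurable_fun setT h ->
  \int[mu]_x h x = \int[mu]_(x in `[0%R, +oo[%classic) h x.
Proof. by move=> mu0 mh; apply: integral_full_set => //; exact: measurable_itv. Qed.

Lemma mean_abs mu : supported_on_Rplus mu -> mean mu = abs_mean mu.
Proof.
move=> mu0; rewrite /mean /abs_mean !integral_Rplus//; last first.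
  by apply/measurable_EFinP; exact: normr_measurable.
by apply: eq_integral => x; rewrite inE/= in_itv/= andbT => x0; rewrite ger0_norm.
Qed.

Lemma log_integralX mu : log_integral 'X mu = \int[mu]_x lne (`|x|%R)%:E.
Proof. by apply: eq_integral => x _; rewrite map_polyX hornerX. Qed.

End Admissibility.

Section SiegelMeasure.
Variable R : realType.
Local Notation leb := (@lebesgue_measure R).
Local Notation RR := (measurableTypeR R).
Variables s q : R.
Hypotheses (s0 : 0 < s) (q0 : 0 < q) (q1 : q < 1).

Let lo := s * (1 - q) ^+ 2.
Let hi := s * (1 + q) ^+ 2.
Let I := `[lo, hi]%classic.
Let nq1 : `|- q| < 1. Proof. by rewrite normrN gtr0_norm. Qed.

Definition from_angle (t : R) : R := s * poisson_den (- q) t.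

(** An affine inverse of [from_angle] at the level of cosines: it makes expressions in [cos t]
    functions of [x] on the whole line, with no [acos]. *)
Definition cos_angle (x : R) : R := (x / s - 1 - q ^+ 2) / (2 * q).

Lemma from_angleE t : from_angle t = s * (1 + q ^+ 2 + 2 * q * cos t).
Proof. by rewrite /from_angle /poisson_den; ring. Qed.

Lemma cos_from_angle t : cos_angle (from_angle t) = cos t.
Proof. by rewrite /cos_angle from_angleE; field; rewrite !lt0r_neq0. Qed.

Lemma from_angle_gt0 t : 0 < from_angle t.
Proof. by rewrite mulr_gt0// poisson_den_gt0. Qed.

Lemma from_angle0 : from_angle 0 = hi.
Proof. by rewrite from_angleE cos0 /hi; ring. Qed.

Lemma from_anglepi : from_angle pi = lo.
Proof. by rewrite from_angleE cospi /lo; ring. Qed.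

Let lo0 : 0 < lo.
Proof. by rewrite -from_anglepi from_angle_gt0. Qed.

Let lohi : lo < hi.
Proof.
rewrite /lo /hi ltr_pM2l// -subr_gt0 (_ : _ - _ = 4 * q) ?mulr_gt0//; ring.
Qed.

Lemma from_angle_range t : lo <= from_angle t <= hi.
Proof.
have := cos_geN1 t; have := cos_le1 t; rewrite from_angleE /lo /hi => c1 c2.
have h1 : 0 <= q * (1 + cos t) by rewrite mulr_ge0 ?(ltW q0)//; lra.
have h2 : 0 <= q * (1 - cos t) by rewrite mulr_ge0 ?(ltW q0)//; lra.
by apply/andP; split; rewrite ler_pM2l//; lra.
Qed.

Lemma from_angle_surj x : lo <= x <= hi -> exists2 t, 0 <= t <= pi & x = from_angle t.
Proof.
move=> /andP[lx xh].
have xs : x = s * (1 + q ^+ 2 + 2 * q * cos_angle x).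
  by rewrite /cos_angle; field; rewrite !lt0r_neq0.
have c : -1 <= cos_angle x <= 1.
  rewrite xs /lo /hi !ler_pM2l// in lx xh.
  by apply/andP; split; rewrite -(ler_pM2l q0); lra.
exists (acos (cos_angle x)); first by rewrite acos_ge0// acos_lepi.
by rewrite from_angleE acosK// in_itv.
Qed.

Lemma is_derive_from_angle (t : R) : is_derive t 1 from_angle (- (2 * s * q * sin t)).
Proof.
have -> : from_angle = fun t => s * (1 + q ^+ 2) + (2 * s * q) * cos t.
  by apply/funext => x; rewrite from_angleE; ring.
have h := is_derive1D (is_derive1_cst (s * (1 + q ^+ 2)) t)
  (is_derive1Z (2 * s * q) (is_derive_cos t)).
by apply: (is_derive_eq h); ring.
Qed.

Lemma integral_from_angle (G : R -> R) : {within I, continuous G} ->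
  (\int[leb]_(x in I) (G x)%:E =
   \int[leb]_(t in `[0%R, (pi : R)]) (G (from_angle t) * (2 * s * q * sin t))%:E)%E.
Proof.
move=> cG; have dF : (from_angle^`())%classic = fun t => - (2 * s * q * sin t).
  by apply/funext => t; rewrite derive1E; exact: (@derive_val _ _ _ _ _ _ _ (is_derive_from_angle t)).
have cdF : continuous (from_angle^`())%classic.
  rewrite dF => t; apply: cvgN; apply: cvgM; [exact: cvg_cst|exact: continuous_sin].
have cF : continuous from_angle.
  by move=> t; exact: is_derive_continuous (is_derive_from_angle t).
rewrite /I -from_anglepi -from_angle0 (@integration_by_substitution_decreasing R from_angle G 0 pi).
- by apply: eq_integral => t _; rewrite dF /= opprK.
- exact: pi_ge0.
- move=> x y; rewrite !in_itv/= => xI yI xy; rewrite /from_angle ltr_pM2l// /poisson_den.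
  have : 0 < q * (cos y - cos x) by rewrite mulr_gt0// subr_gt0 ltr_cos ?in_itv.
  by lra.
- by move=> x _; exact: cdF.
- apply/cvg_ex; eexists; apply: cvg_at_right_filter; exact: cdF.
- apply/cvg_ex; eexists; apply: cvg_at_left_filter; exact: cdF.
- split; first by move=> x _; exact: (@ex_derive _ _ _ _ _ _ _ (is_derive_from_angle x)).
  + by apply: cvg_at_right_filter; exact: cF.
  + by apply: cvg_at_left_filter; exact: cF.
- by rewrite from_anglepi from_angle0.
Qed.

Let sqrt_lohi : Num.sqrt (lo * hi) = s * (1 - q ^+ 2).
Proof.
have -> : lo * hi = (s * (1 - q ^+ 2)) ^+ 2 by rewrite /lo /hi; ring.
by rewrite sqrtr_sqr ger0_norm// mulr_ge0 ?(ltW s0)// subr_ge0 expr_le1 ?(ltW q1) ?(ltW q0).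
Qed.

Let dens := siegel_density lo hi.

Let densE x : dens x = 2 * Num.sqrt ((hi - x) * (x - lo)) / (pi * (4 * s * q ^+ 2) * x).
Proof.
rewrite /dens /siegel_density sqrt_lohi; congr (_ / (_ * _ * _)).
by rewrite /lo /hi; ring.
Qed.

Lemma siegel_density_ge0 x : 0 <= x -> 0 <= dens x.
Proof.
move=> x0; rewrite densE divr_ge0// ?mulr_ge0 ?sqrtr_ge0 ?pi_ge0 ?sqr_ge0 ?(ltW s0) ?(ltW q0)//.
Qed.

Lemma siegel_density_continuous x : 0 < x -> {for x, continuous dens}.
Proof.
move=> x0; have -> : dens = fun x => 2 * Num.sqrt ((hi - x) * (x - lo)) / (pi * (4 * s * q ^+ 2) * x).
  by apply/funext => y; exact: densE.
apply: cvgM.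
  apply: cvgM; first exact: cvg_cst.
  apply: (@continuous_comp _ _ _ (fun x => (hi - x) * (x - lo)) (@Num.sqrt R)).
    by apply: cvgM; apply: cvgB; (exact: cvg_cst || exact: cvg_id).
  exact: sqrt_continuous.
apply: cvgV; last by apply: cvgM; [exact: cvg_cst|exact: cvg_id].
by rewrite !mulf_neq0 ?expf_neq0 ?lt0r_neq0 ?pi_gt0.
Qed.

Let dens_within : {within I, continuous dens}.
Proof.
apply: continuous_in_subspaceT => x; rewrite inE /I/= in_itv/= => /andP[lx _].
by apply: siegel_density_continuous; exact: lt_le_trans lx.
Qed.

Lemma siegel_density_from_angle t : 0 <= t <= pi ->
  dens (from_angle t) * (2 * s * q * sin t) = angle_weight q t.
Proof.
move=> tpi; have st : 0 <= sin t by exact: sin_ge0_pi.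
rewrite densE.
have -> : (hi - from_angle t) * (from_angle t - lo) = (2 * s * q * sin t) ^+ 2.
  have := cos2Dsin2 t => e.
  rewrite from_angleE /lo /hi exprMn.
  have -> : sin t ^+ 2 = 1 - cos t ^+ 2 by rewrite -e addrC addKr.
  by ring.
rewrite sqrtr_sqr ger0_norm; last by rewrite !mulr_ge0// ltW.
rewrite /angle_weight /from_angle; have := poisson_den_gt0 t nq1.
move: (poisson_den _ _) => D D0; move: (pi : R) (pi_gt0 R) => P P0.
by field; rewrite !lt0r_neq0.
Qed.

Lemma integral_siegel_density (G : R -> R) : {within I, continuous G} ->
  (\int[leb]_(x in I) (G x * dens x)%:E = (angle_int q (G \o from_angle))%:E)%E.
Proof.
move=> cG; have cGd : {within I, continuous (fun x => G x * dens x)}.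
  by move=> x; apply: cvgM; [exact: cG|exact: dens_within].
have := integral_from_angle cGd.
have -> : (\int[leb]_(t in `[0%R, pi]) (G (from_angle t) * dens (from_angle t) * (2 * s * q * sin t))%:E =
   \int[leb]_(t in `[0%R, pi]) (G (from_angle t) * angle_weight q t)%:E)%E.
  apply: eq_integral => t; rewrite inE/= in_itv/= => tpi.
  by rewrite -mulrA siegel_density_from_angle.
move=> e; rewrite e /angle_int /Rintegral fineK// -e.
apply: integrable_fin_num => //; first exact: measurable_itv.
exact: continuous_integrable_itv.
Qed.

Let densI : RR -> RR := dens \_ I.

Let densI_ge0 x : 0 <= densI x.
Proof.
rewrite /densI patchE; case: ifPn => //; rewrite inE /I/= in_itv/= => /andP[lx _].
by rewrite siegel_density_ge0// (le_trans (ltW lo0)).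
Qed.

Let measurable_densI : measurable_fun setT densI.
Proof.
apply/measurable_restrict => //; first exact: measurable_itv.
by rewrite setTI; apply: subspace_continuous_measurable_fun => //; exact: measurable_itv.
Qed.

Let densI_total : (\int[leb]_x (densI x)%:E = 1)%E.
Proof.
have -> : (\int[leb]_x (densI x)%:E = \int[leb]_(x in I) (1 * dens x)%:E)%E.
  rewrite [RHS]integral_mkcond; apply: eq_integral => x _.
  by rewrite /densI !patchE; case: ifP => //; rewrite mul1r.
rewrite (integral_siegel_density (G := cst 1)); last by move=> x; exact: cvg_cst.
by rewrite [_ \o _](_ : _ = cst 1)// angle_int_cst.
Qed.

Definition siegel_pdf : density R := Density densI_ge0 measurable_densI densI_total.

Definition siegel_measure : probability RR R := density_prob siegel_pdf.

Local Notation mu0 := siegel_measure.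

Lemma siegel_measure_density : has_density_on mu0 I dens.
Proof.
move=> S mS; rewrite /siegel_measure/= /density_prob integral_mkcondr.
by apply: eq_integral => x _; rewrite /siegel_pdf/= /densI restrict_EFin.
Qed.

Lemma siegel_measure_support : mu0 (~` I) = 0%E.
Proof.
by rewrite siegel_measure_density ?setICl ?integral_set0//; apply: measurableC; exact: measurable_itv.
Qed.

Lemma siegel_measure_point x : mu0 [set x] = 0%E.
Proof.
by rewrite siegel_measure_density// (@integral_Sset1 R _ _ x)// => y [].
Qed.

Lemma integral_siegel_measure (G : RR -> RR) : measurable_fun setT G ->
  {within I, continuous (G : R -> R)} ->
  mu0.-integrable setT (EFin \o G) /\
  (\int[mu0]_x (G x)%:E = (angle_int q (G \o from_angle))%:E)%E.
Proof.
move=> mG cG.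
have mI : measurable (I : set RR) by exact: measurable_itv.
have iG : mu0.-integrable setT (EFin \o G).
  apply/integrableP; split; first exact/measurable_EFinP.
  rewrite (integral_full_set mI siegel_measure_support); last first.
    by apply: measurableT_comp => //; exact/measurable_EFinP.
  have cN : {within I, continuous (fun x : R => `|G x|)} by move=> x; apply: cvg_norm; exact: cG.
  have [c _ hc] := EVT_max (ltW lohi) cN.
  apply: (@le_lt_trans _ _ (\int[mu0]_(x in I) (cst (`|G c|%:E) x))%E).
    apply: ge0_le_integral => //.
    by apply: measurableT_comp => //; apply/measurable_EFinP; exact: measurable_funTS.
  rewrite integral_cst// lte_mul_pinfty// ?lee_fin// -ge0_fin_numE//.
  exact: fin_num_measure.
split=> //; rewrite (integral_density_prob iG) -integral_siegel_density//.
rewrite [RHS]integral_mkcond; apply: eq_integral => x _.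
by rewrite /siegel_pdf/= /densI !patchE; case: ifP => //; rewrite mule0.
Qed.

Variable nu : R.
(** [ln_scale_eq] expresses that [ln x] has integral 0 against the candidate, and [scale_eq] fixes
    the constant in its potential so that its energy is 0. *)
Hypotheses (nu0 : 0 < nu) (q2nu : q ^+ 2 * (nu + 1) = 1).
Hypothesis scale_eq : (nu + 2) * ln s + 2 * ln q = 1.
Hypothesis ln_scale_eq : ln s = 1 + nu * ln (1 - q ^+ 2).

Let q2 : (1 - q ^+ 2) / q ^+ 2 = nu.
Proof.
by rewrite -[X in X - _]q2nu mulrDr mulr1 addrK mulrAC divff ?mul1r// expf_neq0// lt0r_neq0.
Qed.

Lemma angle_int_from_angle : angle_int q from_angle = s.
Proof.
have -> : from_angle = fun t => s * (1 + q ^+ 2) + 2 * s * q * cos (1%:R * t).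
  by apply/funext => t; rewrite from_angleE mul1r; ring.
rewrite angle_intD//; last 2 first.
- by move=> t; exact: cvg_cst.
- by move=> t; apply: cvgM; [exact: cvg_cst|exact: continuous_cos_mul].
rewrite (angle_intZ q0 q1 (2 * s * q) (@continuous_cos_mul R 1)).
rewrite (angle_int_cst q0 q1 (s * (1 + q ^+ 2))) -/(cos_moment q 1).
by have [_ -> _] := cos_moment_values q0 q1; field.
Qed.

Section RegularFunction.
Variable G : RR -> RR.
Hypothesis mG : measurable_fun setT G.
Hypothesis cG : forall x, I x -> {for x, continuous (G : R -> R)}.

Lemma regular_within : {within I, continuous (G : R -> R)}.
Proof. by apply: continuous_in_subspaceT => x; rewrite inE; exact: cG. Qed.

Lemma regular_comp : continuous (G \o from_angle : R -> R).
Proof.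
move=> t; apply: (@continuous_comp _ _ _ from_angle G).
  exact: is_derive_continuous (is_derive_from_angle t).
by apply: cG; rewrite /I/= in_itv/=; exact: from_angle_range.
Qed.

(** [G] is any continuous majorant of [ln |x - y|] on the support: a smoothed kernel when [x] lies
    in the support, the logarithm itself when it lies outside. *)
Lemma gap_potential_lower x : 0 <= x ->
  (forall t, (lne (`|x - from_angle t|%R)%:E <= (G (from_angle t))%:E)%E) ->
  ((x + s - angle_int q (G \o from_angle))%:E <= \int[mu0]_y log_gap (x, y))%E.
Proof.
move=> x0 xG; pose f (y : RR) : RR := x + y - G y.
have mf : measurable_fun setT f by apply: measurable_funB => //; exact: measurable_funD.
have mI : measurable (I : set RR) by exact: measurable_itv.
have cf : {within I, continuous (f : R -> R)}.
  apply: continuous_in_subspaceT => y; rewrite inE => Iy.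
  by apply: cvgB; [apply: cvgD; [exact: cvg_cst|exact: cvg_id]|exact: cG].
have [_ ef] := integral_siegel_measure mf cf.
have <- : (\int[mu0]_x (f x)%:E = (x + s - angle_int q (G \o from_angle))%:E)%E.
  rewrite ef; congr EFin; have cF : continuous from_angle.
    by move=> t; exact: is_derive_continuous (is_derive_from_angle t).
  have -> : f \o from_angle = fun t => (x + from_angle t) + (-1) * (G \o from_angle) t.
    by apply/funext => t; rewrite /f /=; ring.
  rewrite angle_intD//; last 2 first.
  - by move=> t; apply: cvgD; [exact: cvg_cst|exact: cF].
  - by move=> t; apply: cvgM; [exact: cvg_cst|exact: regular_comp].
  rewrite angle_intZ//; last exact: regular_comp.
  rewrite angle_intD//; last by move=> t; exact: cvg_cst.
  by rewrite (angle_int_cst q0 q1 x) angle_int_from_angle mulN1r.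
have mg : measurable_fun setT (fun y => log_gap (x, y)).
  exact: (measurableT_comp (@measurable_log_gap R) (pair1_measurable x)).
rewrite (integral_full_set mI siegel_measure_support mg).
rewrite (integral_full_set mI siegel_measure_support); last exact/measurable_EFinP.
apply: le_integral_ge0 => //.
- by apply/measurable_EFinP; exact: measurable_funTS.
- exact: measurable_funTS.
- by move=> y _; exact: log_gap_ge0.
- move=> y; rewrite /I/= in_itv/= => Iy.
  have [t _ yt] := from_angle_surj Iy.
  have y0 : 0 <= y by rewrite yt ltW// from_angle_gt0.
  rewrite /log_gap/= (ger0_norm x0) (ger0_norm y0) /f EFinB leeB// yt.
  exact: xG.
Qed.

End RegularFunction.

(** Equal to the logarithmic potential of the candidate on the support, and at least as large at the
    other points [x > 0]. *)
Definition equilibrium_potential (x : R) : R := ((nu + 1) * x / s - nu * ln x - (nu + 1)) / 2.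

(* The product [poisson_den r (t - v) * poisson_den r (t + v)] as a polynomial
   in the cosines; its value at [r = 1] is [4 * (cos t - cos v) ^+ 2]. *)
Definition prod_den (r c d : R) : R :=
  (1 + r ^+ 2) ^+ 2 - 4 * r * (1 + r ^+ 2) * c * d + 4 * r ^+ 2 * (c ^+ 2 + d ^+ 2 - 1).

Lemma prod_denE r t v :
  prod_den r (cos t) (cos v) = poisson_den r (t - v) * poisson_den r (t + v).
Proof.
have st : sin t ^+ 2 = 1 - cos t ^+ 2 by rewrite -(cos2Dsin2 t) addrC addKr.
have sv : sin v ^+ 2 = 1 - cos v ^+ 2 by rewrite -(cos2Dsin2 v) addrC addKr.
rewrite /poisson_den cosB cosD.
transitivity ((1 + r ^+ 2 - 2 * r * (cos t * cos v)) ^+ 2 - 4 * r ^+ 2 * sin t ^+ 2 * sin v ^+ 2).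
  by rewrite st sv /prod_den; ring.
by ring.
Qed.

Lemma prod_den_gt0 r t v : `|r| < 1 -> 0 < prod_den r (cos t) (cos v).
Proof. by move=> r1; rewrite prod_denE mulr_gt0// poisson_den_gt0. Qed.

Lemma prod_den_le16 r t v : 0 <= r -> r < 1 -> prod_den r (cos t) (cos v) <= 16.
Proof.
move=> r0 r1; have b w : poisson_den r w <= 4.
  rewrite /poisson_den; have := cos_geN1 w => c.
  have : 0 <= r * (1 + cos w) by rewrite mulr_ge0//; lra.
  have : r ^+ 2 <= 1 by rewrite expr_le1// ltW.
  lra.
  have p w : 0 <= poisson_den r w by rewrite ltW// poisson_den_gt0// ger0_norm.
rewrite prod_denE (_ : 16 = 4 * 4); last by ring.
by apply: ler_pM.
Qed.

(** The factor [r ^+ 2] is the price of smoothing; it becomes the correction [- ln r] of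
    [lne_dist_le], which disappears as [r] tends to 1. *)
Lemma prod_den_lower r t v : 0 <= r -> r < 1 ->
  r ^+ 2 * (4 * (cos t - cos v) ^+ 2) <= prod_den r (cos t) (cos v).
Proof.
move=> r0 r1; rewrite -subr_ge0.
have -> : prod_den r (cos t) (cos v) - r ^+ 2 * (4 * (cos t - cos v) ^+ 2) =
    (1 - r) ^+ 2 * ((1 - r) ^+ 2 + 4 * r * (1 - cos t * cos v)).
  by rewrite /prod_den; ring.
have cc : cos t * cos v <= 1.
  apply: le_trans (ler_norm _) _; rewrite normrM -[leRHS]mulr1.
  by apply: ler_pM => //; rewrite ler_norml cos_geN1 cos_le1.
by rewrite mulr_ge0 ?sqr_ge0// addr_ge0 ?sqr_ge0// !mulr_ge0// subr_ge0.
Qed.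

(** At [r = 1] and off the diagonal this is [ln |from_angle v - y|] on the support. For [r < 1] it
    has no singularity there, and its integral is given by [angle_int_ln_poisson]. *)
Definition smooth_kernel r v (y : RR) : RR :=
  ln (s * q) + ln (prod_den r (cos_angle y) (cos v)) / 2.

Definition smooth_potential r v : R :=
  ln (s * q) + r * cos v / q - nu / 2 * ln (poisson_den (- q * r) v).

Lemma measurable_smooth_kernel r v : measurable_fun setT (smooth_kernel r v).
Proof.
apply: measurable_funD => //; apply: measurable_funM => //.
apply: (measurableT_comp (@measurable_ln R)).
have mc : measurable_fun setT (cos_angle : RR -> RR).
  by apply: measurable_funM => //; do 2! apply: measurable_funB => //; exact: measurable_funM.
rewrite /prod_den; apply: measurable_funD.
  by apply: measurable_funB => //; apply: measurable_funM => //; exact: measurable_funM.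
apply: measurable_funM => //; apply: measurable_funB => //.
by apply: measurable_funD => //; exact: measurable_funX.
Qed.

Lemma smooth_kernel_continuous r v x : `|r| < 1 -> I x ->
  {for x, continuous (smooth_kernel r v : R -> R)}.
Proof.
move=> r1; rewrite /I/= in_itv/= => /from_angle_surj[t _ ->].
have cc : {for from_angle t, continuous cos_angle}.
  apply: cvgM; last exact: cvg_cst.
  apply: cvgB; last exact: cvg_cst.
  apply: cvgB; last exact: cvg_cst.
  by apply: cvgM; [exact: cvg_id|exact: cvg_cst].
apply: cvgD; first exact: cvg_cst.
apply: cvgM; last exact: cvg_cst.
apply: (@continuous_comp _ _ _ (fun y => prod_den r (cos_angle y) (cos v)) (@ln R)).
  apply: cvgD.
    apply: cvgB; first exact: cvg_cst.
    apply: cvgM; last exact: cvg_cst.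
    by apply: cvgM; [exact: cvg_cst|exact: cc].
  apply: cvgM; first exact: cvg_cst.
  apply: cvgB; last exact: cvg_cst.
  apply: cvgD; last exact: cvg_cst.
  by rewrite expr2; apply: cvgM; exact: cc.
by apply: continuous_ln; rewrite cos_from_angle prod_den_gt0.
Qed.

Lemma angle_int_smooth_kernel r v : `|r| < 1 ->
  angle_int q (smooth_kernel r v \o from_angle) = smooth_potential r v.
Proof.
move=> r1.
have -> : smooth_kernel r v \o from_angle = fun t => ln (s * q) +
    2^-1 * (ln (poisson_den r (t - v)) + ln (poisson_den r (t + v))).
  apply/funext => t; rewrite /smooth_kernel/= cos_from_angle prod_denE (mulrC _ 2^-1).
  by congr (_ + _ * _); rewrite lnM ?posrE ?poisson_den_gt0.
have cL : continuous (fun t => ln (poisson_den r (t - v)) + ln (poisson_den r (t + v))).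
  by move=> t; apply: cvgD; exact: continuous_ln_poisson_den.
rewrite angle_intD//; last 2 first.
- by move=> t; exact: cvg_cst.
- by move=> t; apply: cvgM; [exact: cvg_cst|exact: cL].
rewrite angle_intZ// (angle_int_cst q0 q1 (ln (s * q))) angle_int_ln_poisson// q2 /smooth_potential.
by field; rewrite lt0r_neq0.
Qed.

Lemma ln_distE v t : cos v != cos t ->
  ln `|from_angle v - from_angle t| = ln (s * q) + ln (4 * (cos t - cos v) ^+ 2) / 2.
Proof.
move=> vt; have cc : 0 < `|cos v - cos t| by rewrite normr_gt0 subr_eq0.
have -> : from_angle v - from_angle t = s * q * (2 * (cos v - cos t)).
  by rewrite !from_angleE; ring.
have sq : 0 < s * q by exact: mulr_gt0.
have c2 : 0 < 2 * `|cos v - cos t| by exact: mulr_gt0.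
rewrite normrM (gtr0_norm sq) normrM (ger0_norm (ler0n R 2)) [LHS]lnM ?posrE//; congr (_ + _).
have -> : 4 * (cos t - cos v) ^+ 2 = (2 * `|cos v - cos t|) ^+ 2.
  by rewrite exprMn real_normK ?num_real//; ring.
by rewrite lnXn// mulr2n; field.
Qed.

Lemma lne_dist_le r v t : 0 < r -> r < 1 ->
  (lne (`|from_angle v - from_angle t|%R)%:E <=
   (smooth_kernel r v (from_angle t) - ln r)%:E)%E.
Proof.
move=> r0 r1; have [vt|vt] := eqVneq (cos v) (cos t).
  by rewrite !from_angleE vt subrr normr0 le0_lneNy// leNye.
have n0 : 0 < `|from_angle v - from_angle t|.
  rewrite normr_gt0 subr_eq0; apply: contra vt => /eqP e.
  by rewrite -(cos_from_angle v) e cos_from_angle.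
rewrite lne_EFin// lee_fin ln_distE// /smooth_kernel cos_from_angle.
have r1' : `|r| < 1 by rewrite gtr0_norm.
have d0 : 0 < 4 * (cos t - cos v) ^+ 2.
  by rewrite mulr_gt0// lt0r sqr_ge0 sqrf_eq0 subr_eq0 eq_sym vt.
have p0 : 0 < r ^+ 2 * (4 * (cos t - cos v) ^+ 2) by rewrite mulr_gt0// exprn_gt0.
have := prod_den_lower t v (ltW r0) r1.
rewrite -ler_ln ?posrE ?prod_den_gt0//.
have -> : ln (r ^+ 2 * (4 * (cos t - cos v) ^+ 2)) = 2 * ln r + ln (4 * (cos t - cos v) ^+ 2).
  have r2 : 0 < r ^+ 2 by rewrite exprn_gt0.
  by move: (4 * _) d0 => X X0; rewrite lnM ?posrE// lnXn// mulr2n; ring.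
by move: (ln (4 * _)) (ln (prod_den _ _ _)) (ln r) (ln (s * q)) => A B C E; lra.
Qed.

(** With [x = from_angle v], [poisson_den (- q) v] is [x / s]: hence [cos v] is affine in [x], the
    logarithm is [ln x - ln s], and [scale_eq] adjusts the constant. *)
Lemma smooth_potential1 v : smooth_potential 1 v = equilibrium_potential (from_angle v).
Proof.
have D0 : 0 < poisson_den (- q) v by exact: poisson_den_gt0.
rewrite /smooth_potential /equilibrium_potential mulr1 mul1r /from_angle.
rewrite !lnM ?posrE//.
have -> : (nu + 1) * (s * poisson_den (- q) v) / s = (nu + 1) * poisson_den (- q) v.
  by field; rewrite lt0r_neq0.
have -> : (nu + 1) * poisson_den (- q) v = nu + 1 + 1 + 2 * (cos v / q).
  have -> : cos v / q = cos v / q * (q ^+ 2 * (nu + 1)) by rewrite q2nu mulr1.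
  rewrite -[X in _ + X + _]q2nu /poisson_den; field; exact: lt0r_neq0.
by move: (ln (poisson_den _ _)) (cos v / q) (scale_eq) => A B E; lra.
Qed.

Lemma smooth_potential_cvg v :
  smooth_potential r v @[r --> (1 : R)] --> equilibrium_potential (from_angle v).
Proof.
rewrite -smooth_potential1; have D0 : 0 < poisson_den (- q * 1) v by rewrite mulr1; exact: poisson_den_gt0.
apply: cvgB.
  apply: cvgD; first exact: cvg_cst.
  apply: cvgM; last exact: cvg_cst.
  by apply: cvgM; [exact: cvg_id|exact: cvg_cst].
apply: cvgM; first exact: cvg_cst.
apply: (@continuous_comp _ _ _ (fun r : R => poisson_den (- q * r) v) (@ln R)); last exact: continuous_ln.
have cl : {for 1, continuous (fun r : R => - q * r)}.
  by apply: cvgM; [exact: cvg_cst|exact: cvg_id].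
apply: cvgD; last by rewrite expr2; apply: cvgM; exact: cl.
apply: cvgB; first exact: cvg_cst.
apply: cvgM; last exact: cvg_cst.
by apply: cvgM; [exact: cvg_cst|exact: cl].
Qed.

(** Each [r < 1] gives a lower bound by the majorant [smooth_kernel r v y - ln r]; then [r] tends to
    1 from the left. *)
Lemma gap_potential_inside v :
  ((from_angle v + s - equilibrium_potential (from_angle v))%:E
    <= \int[mu0]_y log_gap (from_angle v, y))%E.
Proof.
have x0 : 0 <= from_angle v by rewrite ltW// from_angle_gt0.
have low r : 0 < r -> r < 1 -> ((from_angle v + s - (smooth_potential r v - ln r))%:E
    <= \int[mu0]_y log_gap (from_angle v, y))%E.
  move=> r0 r1; have r1' : `|r| < 1 by rewrite gtr0_norm.
  pose G (y : RR) : RR := smooth_kernel r v y - ln r.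
  have mG : measurable_fun setT G by apply: measurable_funB => //; exact: measurable_smooth_kernel.
  have cG x : I x -> {for x, continuous (G : R -> R)}.
    by move=> Ix; apply: cvgB; [exact: smooth_kernel_continuous|exact: cvg_cst].
  have := gap_potential_lower mG cG x0 (fun t => lne_dist_le v t r0 r1).
  have -> // : angle_int q (G \o from_angle) = smooth_potential r v - ln r.
  have -> : G \o from_angle = fun t => (smooth_kernel r v \o from_angle) t + cst (- ln r) t by [].
  rewrite angle_intD//; last 2 first.
  - by apply: regular_comp => x; exact: smooth_kernel_continuous.
  - by move=> t; exact: cvg_cst.
  by rewrite angle_int_smooth_kernel// (angle_int_cst q0 q1).
move: low; set V := (\int[mu0]_y _)%E => low.
have V0 : (0 <= V)%E by apply: integral_ge0 => y _; exact: log_gap_ge0.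
move: V V0 low => [V V0 low|_ _|//]; last by rewrite leey.
rewrite lee_fin.
have cv : (from_angle v + s - (smooth_potential r v - ln r)) @[r --> (1 : R)^'-] -->
    from_angle v + s - (equilibrium_potential (from_angle v) - ln 1).
  apply: cvg_at_left_filter; apply: cvgB; first exact: cvg_cst.
  apply: cvgB; first exact: smooth_potential_cvg.
  by apply: continuous_ln.
rewrite ln1 subr0 in cv.
rewrite -(cvg_lim (@Rhausdorff R) cv); apply: limr_le.
  by apply/cvg_ex; eexists; exact: cv.
near=> r; rewrite -lee_fin; apply: low; near: r; first exact: nbhs_left_gt.
exact: nbhs_left_lt.
Unshelve. all: by end_near. Qed.

(** * The potential outside the support *)

Lemma joukowski_root (C : R) : 1 < C -> exists2 eta, 0 < eta < 1 & eta + eta^-1 = 2 * C.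
Proof.
move=> C1; pose r := Num.sqrt (C ^+ 2 - 1).
have c2 : 0 < C ^+ 2 - 1 by nra.
have r0 : 0 < r by rewrite sqrtr_gt0.
have r2 : r ^+ 2 = C ^+ 2 - 1 by rewrite sqr_sqrtr// ltW.
have rC : r < C by nra.
have rC1 : C - 1 < r by nra.
exists (C - r); first by apply/andP; split; lra.
have -> : (C - r)^-1 = C + r.
  have n0 : C - r != 0 by rewrite subr_eq0 gt_eqF.
  apply: (mulfI n0); rewrite divff//.
  by rewrite -subr_sqr r2; ring.
ring.
Qed.

(** Outside the support the would-be cosine of [x] exceeds 1 in absolute value, and the Joukowski
    map writes it as half of [eta + eta^-1] up to sign. The sign is carried by [p]: [q] to the right
    of the support, [- q] to the left. Positivity of [x] becomes [0 < eta + p]. *)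
Lemma outside_param x : 0 < x -> ~~ (lo <= x <= hi) ->
  exists p eta, [/\ p = q \/ p = - q, 0 < eta < 1, 0 < eta + p &
    x = s * ((1 + p * eta) * (1 + p / eta))].
Proof.
move=> x0; have xs : x = s * (x / s) by rewrite mulrC divfK// lt0r_neq0.
have xs0 : 0 < x / s by rewrite divr_gt0.
rewrite negb_and -!ltNge => /orP[xlo|xhi].
- have C1 : 1 < (1 + q ^+ 2 - x / s) / (2 * q).
    rewrite ltr_pdivlMr ?mulr_gt0//; move: xlo; rewrite {1}xs /lo ltr_pM2l//; lra.
  have [eta /andP[e0 e1] e] := joukowski_root C1.
  have eE : (1 + - q * eta) * (1 + - q / eta) = x / s.
    have -> : (1 + - q * eta) * (1 + - q / eta) = 1 + q ^+ 2 - q * (eta + eta^-1).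
      by field; rewrite lt0r_neq0.
    by rewrite e; field; rewrite !lt0r_neq0.
  exists (- q), eta; split; [by right|by rewrite e0| |by rewrite eE].
  have qe : 0 < 1 + - q * eta by rewrite mulNr subr_gt0 -[ltRHS]mulr1 ltr_pM// ltW.
  move: xs0; rewrite -eE pmulr_rgt0// => h.
  have -> : eta + - q = (1 + - q / eta) * eta by field; exact: lt0r_neq0.
  exact: mulr_gt0.
- have C1 : 1 < (x / s - 1 - q ^+ 2) / (2 * q).
    rewrite ltr_pdivlMr ?mulr_gt0//; move: xhi; rewrite {1}xs /hi ltr_pM2l//; lra.
  have [eta /andP[e0 e1] e] := joukowski_root C1.
  have eE : (1 + q * eta) * (1 + q / eta) = x / s.
    have -> : (1 + q * eta) * (1 + q / eta) = 1 + q ^+ 2 + q * (eta + eta^-1).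
      by field; rewrite lt0r_neq0.
    by rewrite e; field; rewrite !lt0r_neq0.
  exists q, eta; split; [by left|by rewrite e0|exact: addr_gt0|by rewrite eE].
Qed.

(* With [X = (1 + p * eta) * (1 + p / eta)], the derivative in [eta] is
   [- (nu + 1) * (X - (1 - q) ^+ 2) * (X - (1 + q) ^+ 2) / (X * eta)]. *)
Lemma outside_gap_ge0 (p eta : R) : p = q \/ p = - q -> 0 < eta -> eta <= 1 -> 0 < eta + p ->
  0 <= (nu + 1) * p * (eta^-1 - eta) + (2 + nu) * ln eta
       + nu * ln (1 + p * eta) - nu * ln (eta + p).
Proof.
move=> pq e0 e1 ep.
have p2 : (nu + 1) * p ^+ 2 = 1 by case: pq => ->; rewrite ?sqrrN mulrC.
have pn1 : `|p| < 1 by case: pq => ->; rewrite ?normrN gtr0_norm.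
pose f x := (nu + 1) * p * (x^-1 - x) + (2 + nu) * ln x
       + nu * ln (1 + p * x) - nu * ln (x + p).
pose df x := - (1 - x ^+ 2) ^+ 2 / (x ^+ 2 * (1 + p * x) * (x + p)).
have pos x : eta <= x <= 1 -> [/\ 0 < x, 0 < 1 + p * x & 0 < x + p].
  move=> /andP[ex x1]; have x0 := lt_le_trans e0 ex; split=> //; last lra.
  rewrite -ltrBlDl sub0r; have : `|p * x| < 1 * 1.
    by rewrite normrM (gtr0_norm x0) mulr1; apply: le_lt_trans pn1; rewrite ler_piMr.
  by rewrite mulr1 ltr_norml => /andP[].
have fd (x : R) : eta <= x <= 1 -> is_derive x 1 f (df x).
  move=> /pos[x0 px xp].
  have d1 : is_derive x 1 (fun x : R => 1 + p * x) (0 + p * 1) by exact: is_derive1D.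
  have d2 : is_derive x 1 (fun x : R => x + p) (1 + 0) by exact: is_derive1D.
  have h := is_derive1B (is_derive1D (is_derive1D
    (is_derive1Z ((nu + 1) * p) (is_derive1B (is_deriveV (f := id) (lt0r_neq0 x0) (is_derive1_id x)) (is_derive1_id x)))
    (is_derive1Z (2 + nu) (@is_derive1_ln_comp R id x 1 x0 (is_derive1_id x))))
    (is_derive1Z nu (@is_derive1_ln_comp R (fun x => 1 + p * x) x _ px d1))) (is_derive1Z nu (@is_derive1_ln_comp R (fun x => x + p) x _ xp d2)).
  apply: (is_derive_eq h); rewrite /df /GRing.scale/= mulr1 add0r addr0 mulr1.
  have en : nu = (p ^+ 2)^-1 - 1.
    have pn : p ^+ 2 != 0 by apply/eqP => e; move: p2; rewrite e mulr0 => /eqP; rewrite eq_sym oner_eq0.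
    by apply: (mulIf pn); rewrite mulrBl mulVf// mul1r -[X in X - _]p2; ring.
  have pn : p != 0 by apply/eqP => e; move: p2; rewrite e expr0n mulr0 => /eqP; rewrite eq_sym oner_eq0.
  by rewrite en; field; rewrite pn !lt0r_neq0.
have [c /pos[c0 pc cp] e] := mean_value e1 fd.
have f1 : f 1 = 0 by rewrite /f invr1 ln1 mulr1 (addrC 1 p); ring.
rewrite f1 sub0r in e; rewrite -/(f eta) -oppr_le0 e.
rewrite mulr_le0_ge0 ?subr_ge0// /df mulNr oppr_le0 divr_ge0 ?sqr_ge0//.
by rewrite !mulr_ge0 ?sqr_ge0 ?ltW.
Qed.

Lemma gap_potential_outside x : 0 < x -> ~~ (lo <= x <= hi) ->
  ((x + s - equilibrium_potential x)%:E <= \int[mu0]_y log_gap (x, y))%E.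
Proof.
move=> x0 xI; have [p [eta [pq /andP[e0 e1] ep xE]]] := outside_param x0 xI.
have e0' := lt0r_neq0 e0.
(* With this [z], of modulus [eta < 1], the distance from [x] to [from_angle t] is a multiple of
   [poisson_den z t], and the logarithmic expansion applies directly. *)
pose z := p / q * eta.
have pq1 : `|p / q| = 1.
  by case: pq => ->; rewrite ?mulNr ?normrN divff ?normr1// lt0r_neq0.
have z1 : `|z| < 1 by rewrite normrM pq1 mul1r gtr0_norm.
have sq : 0 < s * q by exact: mulr_gt0.
have distE t : `|x - from_angle t| = s * q / eta * poisson_den z t.
  have -> : x - from_angle t = s * q / eta * poisson_den z t * (p / q).
    rewrite xE from_angleE /poisson_den /z.
    by case: pq => ->; field; rewrite e0' lt0r_neq0.
  rewrite normrM pq1 mulr1 ger0_norm// ltW// mulr_gt0 ?poisson_den_gt0// divr_gt0//.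
pose G (y : RR) : RR := ln (s * q / eta) + ln (1 - 2 * z * cos_angle y + z ^+ 2).
have mG : measurable_fun setT G.
  apply: measurable_funD => //; apply: (measurableT_comp (@measurable_ln R)).
  apply: measurable_funD => //; apply: measurable_funB => //; apply: measurable_funM => //.
  by apply: measurable_funM => //; do 2! apply: measurable_funB => //; exact: measurable_funM.
have cG y : I y -> {for y, continuous (G : R -> R)}.
  rewrite /I/= in_itv/= => /from_angle_surj[t _ ->].
  apply: cvgD; first exact: cvg_cst.
  apply: (@continuous_comp _ _ _ (fun y => 1 - 2 * z * cos_angle y + z ^+ 2) (@ln R)).
    apply: cvgD; last exact: cvg_cst.
    apply: cvgB; first exact: cvg_cst.
    apply: cvgM; first exact: cvg_cst.
    apply: cvgM; last exact: cvg_cst.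
    apply: cvgB; last exact: cvg_cst.
    apply: cvgB; last exact: cvg_cst.
    by apply: cvgM; [exact: cvg_id|exact: cvg_cst].
  by apply: continuous_ln; rewrite cos_from_angle; exact: poisson_den_gt0.
have GF t : G (from_angle t) = ln (s * q / eta) + ln (poisson_den z t).
  by rewrite /G cos_from_angle.
have lnG t : (lne (`|x - from_angle t|%R)%:E <= (G (from_angle t))%:E)%E.
  have d0 : 0 < s * q / eta by rewrite divr_gt0.
  have D0 := poisson_den_gt0 t z1; have dD : 0 < s * q / eta * poisson_den z t by exact: mulr_gt0.
  by rewrite distE (lne_EFin dD) lee_fin GF (lnM d0 D0).
apply: le_trans (gap_potential_lower mG cG (ltW x0) lnG).
rewrite lee_fin lerB//.
have cz : continuous (fun t => ln (poisson_den z (t - 0)) + ln (poisson_den z (t + 0))).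
  by move=> t; apply: cvgD; exact: continuous_ln_poisson_den.
have -> : G \o from_angle = fun t => ln (s * q / eta) +
    2^-1 * (ln (poisson_den z (t - 0)) + ln (poisson_den z (t + 0))).
  by apply/funext => t; rewrite /= GF subr0 addr0; field.
rewrite angle_intD//; last 2 first.
- by move=> t; exact: cvg_cst.
- by move=> t; apply: cvgM; [exact: cvg_cst|exact: cz].
rewrite angle_intZ// (angle_int_cst q0 q1 (ln (s * q / eta))) angle_int_ln_poisson// q2 cos0.
have ppe : 0 < 1 + p * eta.
  by case: pq => ->; [rewrite addr_gt0// mulr_gt0|rewrite mulNr subr_gt0 -[ltRHS]mulr1 ltr_pM// ltW].
have qz : q * z = p * eta by rewrite /z; field; exact: lt0r_neq0.
have -> : poisson_den (- q * z) 0 = (1 + p * eta) ^+ 2.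
  by rewrite mulNr qz /poisson_den cos0; ring.
have -> : 2 * z * 1 / q = 2 * ((nu + 1) * (p * eta)).
  rewrite mulr1 -qz -[LHS]mulr1 -[X in _ * X = _]q2nu; field; exact: lt0r_neq0.
have xE' : x = s * ((1 + p * eta) * ((eta + p) / eta)).
  by rewrite xE; congr (_ * (_ * _)); field.
have lnx : ln x = ln s + ln (1 + p * eta) + ln (eta + p) - ln eta.
  have h1 : 0 < (eta + p) / eta by exact: divr_gt0.
  have h2 : 0 < (1 + p * eta) * ((eta + p) / eta) by exact: mulr_gt0.
  by rewrite xE' (lnM s0 h2) (lnM ppe h1) (ln_div ep e0); ring.
rewrite /equilibrium_potential lnx (ln_div sq e0) (lnM s0 q0) lnXn// -(mulr_natr _ 2).
have xs : (nu + 1) * x / s = (nu + 1) + 1 + (nu + 1) * p * (eta^-1 - eta) + 2 * ((nu + 1) * (p * eta)).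
  have p2 : (nu + 1) * p ^+ 2 = 1 by case: pq => ->; rewrite ?sqrrN mulrC.
  rewrite -[X in _ + X + _ + _]p2 xE; field.
  by rewrite e0' lt0r_neq0.
(* Using [scale_eq], the difference of the two sides is half the quantity in [outside_gap_ge0]. *)
rewrite xs; have := outside_gap_ge0 pq e0 (ltW e1) ep.
move: scale_eq.
move: ((nu + 1) * p * _) ((nu + 1) * (p * eta)) => A B.
move: (ln eta) (ln (1 + p * eta)) (ln (eta + p)) (ln s) (ln q) => E0 E1 E2 E3 E4.
lra.
Qed.

Lemma gap_potential_ge x : 0 < x ->
  ((x + s - equilibrium_potential x)%:E <= \int[mu0]_y log_gap (x, y))%E.
Proof.
move=> x0; have [/from_angle_surj[t _ ->]|] := boolP (lo <= x <= hi).
  exact: gap_potential_inside.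
exact: gap_potential_outside.
Qed.

Lemma prod_den_cvg c d : prod_den r c d @[r --> (1 : R)] --> 4 * (c - d) ^+ 2.
Proof.
have -> : 4 * (c - d) ^+ 2 = prod_den 1 c d by rewrite /prod_den; ring.
have cr2 : r ^+ 2 @[r --> (1 : R)] --> (1 : R) ^+ 2.
  by rewrite expr2; apply: cvgM; exact: cvg_id.
have cr3 : 1 + r ^+ 2 @[r --> (1 : R)] --> 1 + (1 : R) ^+ 2.
  by apply: cvgD => //; exact: cvg_cst.
apply: cvgD; last by apply: cvgM; [apply: cvgM => //; exact: cvg_cst|exact: cvg_cst].
apply: cvgB; first by rewrite !expr2; apply: cvgM; exact: cr3.
do 2 (apply: cvgM; last exact: cvg_cst).
by apply: cvgM; [apply: cvgM; [exact: cvg_cst|exact: cvg_id]|exact: cr3].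
Qed.

Lemma smooth_kernel_le r v t : 0 <= r -> r < 1 ->
  smooth_kernel r v (from_angle t) <= ln (s * q) + ln 16 / 2.
Proof.
move=> r0 r1; rewrite /smooth_kernel cos_from_angle lerD2l ler_pM2r ?invr_gt0//.
have r1' : `|r| < 1 by rewrite ger0_norm.
by rewrite ler_ln ?posrE ?prod_den_gt0//; exact: prod_den_le16.
Qed.

Lemma smooth_kernel_cvg v t : cos v != cos t ->
  smooth_kernel r v (from_angle t) @[r --> (1 : R)] --> ln `|from_angle v - from_angle t|.
Proof.
move=> vt; rewrite ln_distE//; apply: cvgD; first exact: cvg_cst.
apply: cvgM; last exact: cvg_cst.
rewrite cos_from_angle; have d0 : 0 < 4 * (cos t - cos v) ^+ 2.
  by rewrite mulr_gt0// lt0r sqr_ge0 sqrf_eq0 subr_eq0 eq_sym vt.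
apply: (@cvg_comp _ _ _ (fun r => prod_den r (cos t) (cos v)) (@ln R)).
  exact: prod_den_cvg.
exact: continuous_ln.
Qed.

(** Fatou's lemma along radii tending to 1 gives the inequality opposite to [gap_potential_inside].
    It is what bounds the self-energy of the candidate. *)
Lemma gap_potential_le v :
  (\int[mu0]_y log_gap (from_angle v, y) <=
   (from_angle v + s - equilibrium_potential (from_angle v))%:E)%E.
Proof.
set x := from_angle v; have x0 : 0 < x by exact: from_angle_gt0.
have mI : measurable (I : set RR) by exact: measurable_itv.
(* The singular point is removed, which costs nothing since the measure has no atoms; elsewhere on
   the support the smoothed kernels converge to the logarithm. *)
pose D : set RR := I `\ x.
have mD : measurable D by exact: measurableD.
have D0 : mu0 (~` D) = 0%E.
  apply/eqP; rewrite eq_le measure_ge0 andbT setCD.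
  rewrite -[leRHS](adde0 0%E) -[X in (_ <= X + _)%E]siegel_measure_support -(siegel_measure_point x).
  by apply: measureU2 => //; exact: measurableC.
pose rn (n : nat) : R := 1 - harmonic n.
have rn0 n : 0 <= rn n by rewrite subr_ge0 invf_le1 ?ler1n.
have rn1 n : rn n < 1 by rewrite ltrBlDr ltrDl invr_gt0.
have rnc : rn n @[n --> \oo] --> (1 : R).
  by rewrite -[X in _ --> X]subr0; apply: cvgB; [exact: cvg_cst|exact: cvg_harmonic].
(* By [smooth_kernel_le], adding [c] makes all integrands nonnegative, as Fatou's lemma requires. *)
pose c : R := `|ln (s * q) + ln 16 / 2|.
pose f n (y : RR) : RR := x + y + c - smooth_kernel (rn n) v y.
have mf n : measurable_fun setT (f n).
  apply: measurable_funB; last exact: measurable_smooth_kernel.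
  by apply: measurable_funD => //; exact: measurable_funD.
have f0 n y : D y -> (0 <= (f n y)%:E)%E.
  move=> [+ _]; rewrite /I/= in_itv/= => /from_angle_surj[t _ ->].
  rewrite lee_fin subr_ge0; apply: le_trans (smooth_kernel_le _ _ (rn0 n) (rn1 n)) _.
  apply: le_trans (ler_norm _) _; rewrite lerDr addr_ge0 ?(ltW x0)//.
  exact/ltW/from_angle_gt0.
have rnn n : `|rn n| < 1 by rewrite ger0_norm.
have If n : (\int[mu0]_(y in D) (f n y)%:E = (x + s + c - smooth_potential (rn n) v)%:E)%E.
  have mfn : measurable_fun setT (EFin \o f n) by apply/measurable_EFinP; exact: mf.
  rewrite -(integral_full_set mD D0 mfn).
  have cf y : I y -> {for y, continuous (f n : R -> R)}.
    move=> Iy; apply: cvgB; last exact: smooth_kernel_continuous.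
    by apply: cvgD; [apply: cvgD; [exact: cvg_cst|exact: cvg_id]|exact: cvg_cst].
  have [_ ->] := integral_siegel_measure (mf n) (regular_within cf); congr EFin.
  have cF : continuous from_angle.
    by move=> t; exact: is_derive_continuous (is_derive_from_angle t).
  have cK : continuous (smooth_kernel (rn n) v \o from_angle : R -> R).
    by apply: regular_comp => y; exact: smooth_kernel_continuous.
  have -> : f n \o from_angle = fun t => (x + c + from_angle t) +
      (-1) * (smooth_kernel (rn n) v \o from_angle) t.
    by apply/funext => t; rewrite /f /=; ring.
  rewrite angle_intD//; last 2 first.
  - by move=> t; apply: cvgD; [exact: cvg_cst|exact: cF].
  - by move=> t; apply: cvgM; [exact: cvg_cst|exact: cK].
  rewrite angle_intZ// angle_intD//; last by move=> t; exact: cvg_cst.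
  rewrite (angle_int_cst q0 q1 (x + c)) angle_int_from_angle angle_int_smooth_kernel//.
  by ring.
have mfD n : measurable_fun D (EFin \o f n).
  by apply/measurable_EFinP; apply: measurable_funTS; exact: mf.
have := fatou mu0 mD mfD f0.
have -> : limn_einf (fun n => \int[mu0]_(y in D) (EFin \o f n) y)%E =
    (x + s + c - equilibrium_potential x)%:E.
  have [] // := @cvg_limn_einf_sup R (fun n => \int[mu0]_(y in D) (EFin \o f n) y)%E
    (x + s + c - equilibrium_potential x)%:E.
  have -> : (fun n => \int[mu0]_(y in D) (EFin \o f n) y)%E =
      EFin \o (fun n => x + s + c - smooth_potential (rn n) v) by apply/funext => n; rewrite If.
  apply: cvg_EFin; first exact: nearW.
  apply: cvgB; first exact: cvg_cst.
  apply: (@cvg_comp _ _ _ rn (fun r => smooth_potential r v) _ _ _ rnc).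
  exact: smooth_potential_cvg.
have -> : (\int[mu0]_(y in D) limn_einf (fun n => (EFin \o f n) y) =
    \int[mu0]_(y in D) (log_gap (x, y) + c%:E))%E.
  apply: eq_integral => y; rewrite inE => -[+ yx]; rewrite /I/= in_itv/= => /from_angle_surj[t _ yt].
  have vt : cos v != cos t.
    by apply: contra_not_neq yx; rewrite yt /x !from_angleE => ->.
  have [] // := @cvg_limn_einf_sup R (fun n => (EFin \o f n) y) (log_gap (x, y) + c%:E)%E.
  have n0 : 0 < `|x - y|.
    by rewrite normr_gt0 subr_eq0 eq_sym; apply/eqP.
  have -> : log_gap (x, y) = (`|x| + `|y| - ln `|x - y|)%:E by rewrite /log_gap (lne_EFin n0).
  rewrite -EFinD.
  apply: cvg_EFin; first exact: nearW.
  rewrite (gtr0_norm x0) gtr0_norm; last by rewrite yt from_angle_gt0.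
  rewrite addrAC; apply: cvgB; first exact: cvg_cst.
  rewrite yt; apply: (@cvg_comp _ _ _ rn (fun r => smooth_kernel r v (from_angle t)) _ _ _ rnc).
  exact: smooth_kernel_cvg.
have mg : measurable_fun setT (fun y => log_gap (x, y)).
  exact: (measurableT_comp (@measurable_log_gap R) (pair1_measurable x)).
rewrite ge0_integralD//; last 3 first.
- by move=> y _; exact: log_gap_ge0.
- exact: measurable_funTS.
- by move=> y _; rewrite lee_fin normr_ge0.
have -> : (\int[mu0]_(_ in D) c%:E = c%:E)%E.
  by rewrite -(integral_full_set mD D0)// integral_cst//= probability_setT mule1.
rewrite -(integral_full_set mD D0 mg) => h; rewrite -(leeD2rE _ _ (isT : c%:E \is a fin_num)).
by apply: le_trans h _; rewrite -EFinD lee_fin addrAC.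
Qed.

(** * Admissibility and optimality of the candidate *)

Lemma abs_mean_siegel_measure : abs_mean mu0 = s%:E.
Proof.
rewrite /abs_mean; have mI : measurable (I : set RR) by exact: measurable_itv.
have mn : measurable_fun setT (fun x : RR => `|x|%R : RR) by exact: normr_measurable.
have cn : {within I, continuous ((fun x : RR => `|x|%R : RR) : R -> R)}.
  by apply: continuous_subspaceT => x; exact: (cvg_norm (@cvg_id _ _)).
have [_ ->] := integral_siegel_measure mn cn.
congr EFin; rewrite -angle_int_from_angle; congr angle_int.
by apply/funext => t; rewrite /= gtr0_norm// from_angle_gt0.
Qed.

Lemma continuous_ln_from_angle : continuous (@ln R \o from_angle).
Proof.
move=> t; apply: continuous_comp; last exact/continuous_ln/from_angle_gt0.
exact: is_derive_continuous (is_derive_from_angle t).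
Qed.

(** The case [z = - q], [v = 0] of [angle_int_ln_poisson] gives [ln s - 1 - nu * ln (1 - q ^+ 2)],
    which is 0 by [ln_scale_eq]: the constraint of ['X] is tight. *)
Lemma angle_int_ln_from_angle : angle_int q (@ln R \o from_angle) = 0.
Proof.
have D0 t : 0 < poisson_den (- q) t by exact: poisson_den_gt0.
have cz : continuous (fun t => ln (poisson_den (- q) (t - 0)) + ln (poisson_den (- q) (t + 0))).
  by move=> t; apply: cvgD; exact: continuous_ln_poisson_den.
have -> : @ln R \o from_angle = fun t => ln s +
    2^-1 * (ln (poisson_den (- q) (t - 0)) + ln (poisson_den (- q) (t + 0))).
  by apply/funext => t; rewrite /= /from_angle (lnM s0 (D0 t)) subr0 addr0; field.
rewrite angle_intD//; last 2 first.
- by move=> t; exact: cvg_cst.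
- by move=> t; apply: cvgM; [exact: cvg_cst|exact: cz].
rewrite angle_intZ// (angle_int_cst q0 q1 (ln s)) angle_int_ln_poisson// q2.
have q21 : 0 < 1 - q ^+ 2 by rewrite subr_gt0 expr_lt1// ltW.
have -> : poisson_den (- q * - q) 0 = (1 - q ^+ 2) ^+ 2.
  by rewrite /poisson_den cos0; ring.
rewrite lnXn// -(mulr_natr _ 2) cos0 ln_scale_eq.
by field; exact: lt0r_neq0.
Qed.

Lemma integral_ln_siegel_measure : (\int[mu0]_x lne (`|x|%R)%:E = 0)%E.
Proof.
have mI : measurable (I : set RR) by exact: measurable_itv.
have mL : measurable_fun setT (fun x : RR => ln `|x| : RR).
  by apply: (measurableT_comp (@measurable_ln R)); exact: normr_measurable.
transitivity (\int[mu0]_(x in I) (ln `|x|)%:E)%E.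
  rewrite (integral_full_set mI siegel_measure_support).
    apply: eq_integral => x; rewrite inE => Ix.
    have x0 : 0 < `|x|.
      by move: Ix; rewrite /I/= in_itv/= => /andP[lx _]; rewrite normr_gt0 lt0r_neq0// (lt_le_trans lo0).
    by rewrite lne_EFin.
  exact: (measurableT_comp (@measurable_lne_EFin R) (@normr_measurable R setT)).
rewrite -(integral_full_set mI siegel_measure_support); last exact/measurable_EFinP.
have cL : {within I, continuous ((fun x : RR => ln `|x| : RR) : R -> R)}.
  apply: continuous_in_subspaceT => x; rewrite inE /I/= in_itv/= => /andP[lx _].
  apply: continuous_comp; first exact: cvg_norm cvg_id.
  by apply: continuous_ln; rewrite normr_gt0 lt0r_neq0// (lt_le_trans lo0).
have [_ ->] := integral_siegel_measure mL cL; congr EFin; rewrite -angle_int_ln_from_angle.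
by congr angle_int; apply/funext => t; rewrite /= gtr0_norm// from_angle_gt0.
Qed.

Lemma measurable_equilibrium_potential : measurable_fun setT (equilibrium_potential : RR -> RR).
Proof.
apply: measurable_funM => //; do 2! apply: measurable_funB => //.
- by apply: measurable_funM => //; exact: measurable_funM.
- by apply: measurable_funM => //; exact: measurable_ln.
Qed.

Lemma equilibrium_potential_continuous x : I x -> {for x, continuous equilibrium_potential}.
Proof.
rewrite /I/= in_itv/= => /andP[lx _].
apply: cvgM; last exact: cvg_cst.
apply: cvgB; last exact: cvg_cst.
apply: cvgB; last first.
  by apply: cvgM; [exact: cvg_cst|exact/continuous_ln/(lt_le_trans lo0)].
apply: cvgM; last exact: cvg_cst.
by apply: cvgM; [exact: cvg_cst|exact: cvg_id].
Qed.

(** The mean [s] and the zero integral of [ln x] leave [(nu + 1) - (nu + 1)]. Being the integral of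
    the potential, this is the energy of the candidate. *)
Lemma angle_int_equilibrium_potential : angle_int q (equilibrium_potential \o from_angle) = 0.
Proof.
have cF : continuous from_angle.
  by move=> t; exact: is_derive_continuous (is_derive_from_angle t).
have -> : equilibrium_potential \o from_angle = fun t => - ((nu + 1) / 2) +
    ((nu + 1) / s / 2 * from_angle t + (- (nu / 2)) * (@ln R \o from_angle) t).
  apply/funext => t; rewrite /equilibrium_potential/=.
  by move: (ln _) => L; field; exact: lt0r_neq0.
have c1 : continuous (fun t => (nu + 1) / s / 2 * from_angle t).
  by move=> t; apply: cvgM; [exact: cvg_cst|exact: cF].
have c2 : continuous (fun t => - (nu / 2) * (@ln R \o from_angle) t).
  by move=> t; apply: cvgM; [exact: cvg_cst|exact: continuous_ln_from_angle].
rewrite angle_intD//; last 2 first.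
- by move=> t; exact: cvg_cst.
- by move=> t; apply: cvgD; [exact: c1|exact: c2].
rewrite (angle_intD q0 q1 c1 c2) (angle_intZ q0 q1 _ cF) (angle_intZ q0 q1 _ continuous_ln_from_angle).
rewrite (angle_int_cst q0 q1 (- ((nu + 1) / 2))) angle_int_from_angle angle_int_ln_from_angle.
by field; exact: lt0r_neq0.
Qed.

Lemma gap_energy_siegel_measure : (gap_energy mu0 mu0 <= (2 * s)%:E)%E.
Proof.
have mI : measurable (I : set RR) by exact: measurable_itv.
rewrite /gap_energy fubini_tonelli1/=; last 2 first.
- exact: measurable_log_gap.
- by move=> z; exact: log_gap_ge0.
pose G (x : RR) : RR := x + s - equilibrium_potential x.
have mG : measurable_fun setT G.
  by apply: measurable_funB; [exact: measurable_funD|exact: measurable_equilibrium_potential].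
have cG x : I x -> {for x, continuous (G : R -> R)}.
  move=> Ix; apply: cvgB; last exact: equilibrium_potential_continuous.
  by apply: cvgD; [exact: cvg_id|exact: cvg_cst].
have cF : continuous from_angle.
  by move=> t; exact: is_derive_continuous (is_derive_from_angle t).
have -> : 2 * s = angle_int q (G \o from_angle).
  have cW := regular_comp equilibrium_potential_continuous.
  have -> : G \o from_angle = fun t => (s + from_angle t) +
      (-1) * (equilibrium_potential \o from_angle) t.
    by apply/funext => t; rewrite /G /=; ring.
  rewrite angle_intD//; last 2 first.
  - by move=> t; apply: cvgD; [exact: cvg_cst|exact: cF].
  - by move=> t; apply: cvgM; [exact: cvg_cst|exact: cW].
  rewrite angle_intZ// angle_int_equilibrium_potential angle_intD//; last by move=> t; exact: cvg_cst.
  by rewrite (angle_int_cst q0 q1 s) angle_int_from_angle; ring.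
have [_ <-] := integral_siegel_measure mG (regular_within cG).
have mV : measurable_fun setT (fubini_F mu0 (@log_gap R)).
  by apply: measurable_fun_fubini_tonelli_F; [exact: measurable_log_gap|exact: log_gap_ge0].
rewrite (integral_full_set mI siegel_measure_support mV).
rewrite (integral_full_set mI siegel_measure_support); last exact/measurable_EFinP.
apply: ge0_le_integral => //.
- by move=> x _; apply: integral_ge0 => y _; exact: log_gap_ge0.
- exact: measurable_funTS.
- by apply/measurable_EFinP; exact: measurable_funTS.
- move=> x; rewrite /I/= in_itv/= => /from_angle_surj[t _ ->].
  exact: gap_potential_le.
Qed.

(** The potential inequality is integrated as [F <= G], with the logarithm on the left and the
    linear term on the right, so that [G] is nonnegative and no infinite terms are subtracted. *)
Lemma gap_energy_siegel_measure_ge (mu : probability RR R) M :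
  supported_on_Rplus mu -> abs_mean mu = M%:E -> (0 <= \int[mu]_x lne (`|x|%R)%:E)%E ->
  ((M + s - (nu + 1) / 2 * (M / s - 1))%:E <= gap_energy mu mu0)%E.
Proof.
move=> muP mM E1; pose a : R := (nu + 1) / 2; pose b : R := a / s.
have a0 : 0 <= a by rewrite divr_ge0// addr_ge0// ltW.
have b0 : 0 <= b by rewrite divr_ge0// ltW.
have mn : measurable_fun setT (fun x : RR => (`|x|%R)%:E).
  by apply/measurable_EFinP; exact: normr_measurable.
have iN := integrable_norm mM.
have iL : mu.-integrable setT (fun x : RR => lne (`|x|%R)%:E).
  apply: integrable_integral_ge0 iN _ _ E1 => //; first exact: measurable_lne_norm.
  by move=> x; exact: lne_le_norm.
pose F (x : RR) : \bar R := ((`|x|%R)%:E + (s + a)%:E + (nu / 2)%:E * lne (`|x|%R)%:E)%E.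
pose V (x : RR) : \bar R := (\int[mu0]_y log_gap (x, y))%E.
have V0 x : (0 <= V x)%E by apply: integral_ge0 => y _; exact: log_gap_ge0.
have mV : measurable_fun setT V.
  apply: (measurable_fun_fubini_tonelli_F (m2 := mu0) (@log_gap R)).
    exact: measurable_log_gap.
  exact: log_gap_ge0.
have iV : (\int[mu]_x V x = gap_energy mu mu0)%E.
  rewrite /gap_energy fubini_tonelli1//=; first exact: measurable_log_gap.
  by move=> z; exact: log_gap_ge0.
have ic : mu.-integrable setT (EFin \o cst (s + a)) by exact: finite_measure_integrable_cst.
have iF : (\int[mu]_x F x = M%:E + (s + a)%:E + (nu / 2)%:E * \int[mu]_x lne (`|x|%R)%:E)%E.
  have iNc := integrableD measurableT iN ic.
  rewrite integralD//; last exact: integrableZl.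
  rewrite integralD// integralZl// -/(abs_mean mu) mM.
  by rewrite integral_cst//= probability_setT mule1.
have mF : measurable_fun setT F.
  apply: emeasurable_funD; first exact: emeasurable_funD.
  by apply: measurable_funeM; exact: measurable_lne_norm.
pose G (x : RR) : \bar R := (V x + b%:E * (`|x|%R)%:E)%E.
have mG : measurable_fun setT G by apply: emeasurable_funD => //; exact: measurable_funeM.
have iG : (\int[mu]_x G x = gap_energy mu mu0 + (b * M)%:E)%E.
  rewrite ge0_integralD//; last 2 first.
  - by move=> x _; rewrite -EFinM lee_fin mulr_ge0.
  - exact: measurable_funeM.
  by rewrite iV ge0_integralZl_EFin// -/(abs_mean mu) mM EFinM.
have FG : (\int[mu]_x F x <= \int[mu]_x G x)%E.
  rewrite (integral_Rplus muP mF) (integral_Rplus muP mG).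
  apply: le_integral_ge0.
  - exact: measurable_itv.
  - exact: measurable_funTS.
  - exact: measurable_funTS.
  - by move=> x _; rewrite adde_ge0// -EFinM lee_fin mulr_ge0.
  (* At [x = 0], where [gap_potential_ge] is silent, [F] is [-oo] because [nu > 0]. *)
  move=> x; rewrite /= in_itv/= andbT le_eqVlt => /predU1P[<-|x0].
    by rewrite /F normr0 le0_lneNy// gt0_muleNy ?lte_fin ?divr_gt0// addeNy leNye.
  have xn : 0 < `|x| by rewrite gtr0_norm.
  rewrite /F /G (lne_EFin xn) (gtr0_norm x0).
  apply: le_trans (leeD (gap_potential_ge x0) (lexx _)).
  rewrite -!EFinM -!EFinD lee_fin /equilibrium_potential /b /a.
  rewrite le_eqVlt; apply/orP; left; apply/eqP.
  by move: (ln x) => L; field; exact: lt0r_neq0.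
move: FG; rewrite iF iG => FG.
rewrite -(leeD2rE _ _ (isT : (b * M)%:E \is a fin_num)); apply: le_trans FG.
apply: (@le_trans _ _ (M%:E + (s + a)%:E)%E); last first.
  by rewrite leeDl// mule_ge0// lee_fin divr_ge0// ltW.
rewrite -!EFinD lee_fin /b /a le_eqVlt; apply/orP; left; apply/eqP.
by field; exact: lt0r_neq0.
Qed.

Lemma hat_distance_siegel_measure (mu : probability RR R) M :
  admissible [fset 'X]%fset mu -> abs_mean mu = M%:E ->
  (hat_distance (expR 1) mu mu0 <= ((nu + 1) * (M / s - 1))%:E)%E.
Proof.
move=> [muP E0 EX] mM.
have E1 : (0 <= \int[mu]_x lne (`|x|%R)%:E)%E.
  by rewrite -log_integralX; apply: EX; rewrite inE.
have := gap_energy_ineq mM abs_mean_siegel_measure (gap_energy_le mM E0) gap_energy_siegel_measure.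
have := gap_energy_siegel_measure_ge muP mM E1.
have h0 : (0 <= hat_distance (expR 1) mu mu0)%E.
  apply: integral_ge0 => o _; rewrite lee_fin mulr_ge0 ?sqr_ge0//.
  exact: hat_weight_ge0.
move: h0; case: (hat_distance _ _ _) => [h h0| _ |//]; last first.
  by case: (gap_energy _ _) => [g|_|//]; rewrite // mulry gtr0_sg ?mul1e.
case: (gap_energy _ _) => [g|_|//]; last by rewrite mulry gtr0_sg ?mul1e.
rewrite -EFinM -EFinD !lee_fin; lra.
Qed.

Lemma siegel_measure_Rplus : supported_on_Rplus mu0.
Proof.
apply/eqP; rewrite eq_le measure_ge0 andbT -siegel_measure_support.
apply: le_measure; rewrite ?inE.
- by apply: measurableC; exact: measurable_itv.
- by apply: measurableC; exact: measurable_itv.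
apply: subsetC => x; rewrite /I/= !in_itv/= andbT => /andP[lx _].
exact: le_trans (ltW lo0) lx.
Qed.

Lemma siegel_measure_admissible : admissible [fset 'X]%fset mu0.
Proof.
split; first exact: siegel_measure_Rplus.
  exact: log_energy_ge0 abs_mean_siegel_measure gap_energy_siegel_measure.
by move=> Q; rewrite inE => /eqP ->; rewrite log_integralX integral_ln_siegel_measure.
Qed.

Lemma mean_siegel_measure : mean mu0 = s%:E.
Proof. by rewrite mean_abs ?abs_mean_siegel_measure//; exact: siegel_measure_Rplus. Qed.

Lemma lambda_X : lambda R [fset 'X]%fset = s%:E.
Proof.
apply/eqP; rewrite eq_le; apply/andP; split.
  by apply: ereal_inf_lbound; exists mu0; [exact: siegel_measure_admissible|exact: mean_siegel_measure].
apply: le_ereal_inf_tmp => _ [mu amu <-]; have [muP _ _] := amu.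
rewrite mean_abs//; have M0 : (0 <= abs_mean mu)%E by exact: integral_ge0.
(* A measure of infinite mean cannot lower the infimum. *)
case mM : (abs_mean mu) M0 => [M| |//] M0; last by rewrite leey.
have h := hat_distance_siegel_measure amu mM.
have : (0 <= ((nu + 1) * (M / s - 1))%:E :> \bar R)%E.
  apply: le_trans h; apply: integral_ge0 => o _; rewrite lee_fin mulr_ge0 ?sqr_ge0//.
  exact: hat_weight_ge0.
by rewrite lee_fin pmulr_rge0 ?addr_gt0// subr_ge0 ler_pdivlMr// mul1r lee_fin.
Qed.

Lemma siegel_measure_extremal : is_extremal_measure [fset 'X]%fset mu0.
Proof.
split.
  by split; [exact: siegel_measure_admissible|rewrite lambda_X; exact: mean_siegel_measure].
move=> mu [amu]; rewrite lambda_X; have [muP _ _] := amu; rewrite mean_abs// => mM.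
apply: (hat_distance_eq0 (expR_gt0 1)); apply/eqP; rewrite eq_le.
have := hat_distance_siegel_measure amu mM.
rewrite divff ?lt0r_neq0// subrr mulr0 => -> /=.
apply: integral_ge0 => o _; rewrite lee_fin mulr_ge0 ?sqr_ge0//.
exact: hat_weight_ge0.
Qed.

End SiegelMeasure.

Theorem corollary1p4 (R : realType) :
  (exists! nu : R, siegel_root nu) /\
  (forall nu : R, siegel_root nu ->
    [/\ lambda R [fset 'X]%fset = (siegel_value nu)%:E,
        1 + 733 / 10 ^+ 3 + 610 / 10 ^+ 6 + 5 / 10 ^+ 7 <= siegel_value nu
          < 1 + 733 / 10 ^+ 3 + 610 / 10 ^+ 6 + 6 / 10 ^+ 7 &
        exists mu : probability (measurableTypeR R) R,
          is_extremal_measure [fset 'X]%fset mu /\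
          has_density_on mu `[left_end nu, right_end nu]
            (siegel_density (left_end nu) (right_end nu))]).
Proof.
split; first exact: siegel_root_exists_unique.
move=> nu root; have [nu0 _] := root; have [s0 lns lns2] := siegel_root_ln root.
pose q : R := 1 / Num.sqrt (nu + 1).
have r0 : 0 < Num.sqrt (nu + 1) by rewrite sqrtr_gt0 addr_gt0.
have r1 : 1 < Num.sqrt (nu + 1) by rewrite -[ltLHS]sqrtr1 ltr_sqrt ?addr_gt0// ltrDr.
have q0 : 0 < q by rewrite divr_gt0.
have q1 : q < 1 by rewrite ltr_pdivrMr// mul1r.
have q2 : q ^+ 2 = (nu + 1)^-1 by rewrite expr_div_n expr1n sqr_sqrtr ?addr_ge0 ?ltW// mul1r.
have q2nu : q ^+ 2 * (nu + 1) = 1 by rewrite q2 mulVf// lt0r_neq0// addr_gt0.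
have n1 : 0 < nu + 1 by exact: addr_gt0.
have scale_eq : (nu + 2) * ln (siegel_value nu) + 2 * ln q = 1.
  by rewrite lns2 mulr_natl -lnXn// q2 lnV ?posrE// (addrC nu) addrK.
have ln_scale_eq : ln (siegel_value nu) = 1 + nu * ln (1 - q ^+ 2).
  have -> : 1 - q ^+ 2 = nu / (nu + 1) by rewrite q2; field; exact: lt0r_neq0.
  by rewrite lns ln_div ?posrE// (addrC nu 1); ring.
split.
- exact: (lambda_X s0 q0 q1 nu0 q2nu scale_eq ln_scale_eq).
- exact: siegel_value_bounds.
exists (siegel_measure s0 q0 q1); split.
  exact: (siegel_measure_extremal s0 q0 q1 nu0 q2nu scale_eq ln_scale_eq).
(* [left_end nu] and [right_end nu] unfold to the ends of the support for this [q]. *)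
exact: siegel_measure_density.
Qed.
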